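(* Let $\rho:\mathfrak g\to\mathfrak{gl}(V)$ be a representation of a finite-dimensional complex Lie algebra $\mathfrak g$ on a finite-dimensional complex vector space $V$. Assume that $f_1,\dots,f_q$ are algebraically independent invariant polynomials of $\rho$, numbered so that $\deg f_1\le\dots\le\deg f_q$, where $q=\operatorname{codim}\mathcal O_{\mathrm{reg}}$. Let $\mathsf v_1(\rho)\le\dots\le\mathsf v_q(\rho)$ be the vertical indices of $\rho$. Then: 1. If the degrees of the $f_i$ are equal to the vertical indices, $\deg f_i=\mathsf v_i(\rho)$ for all $i$ (equivalently, $\sum_i\deg f_i=\sum_i\mathsf v_i(\rho)$), then the algebra $\mathbb C[V]^{\mathfrak g}$ of polynomial invariants of $\rho$ is freely generated by $f_1,\dots,f_q$ (i.e. it is a polynomial algebra). 2. Conversely, if the algebra $\mathbb C[V]^{\mathfrak g}$ of polynomial invariants of $\rho$ is freely generated by $f_1,\dots,f_q$, and, in addition, $\rho$ has no proper semi-invariants (i.e. any semi-invariant is an invariant), then the degrees of the $f_i$ are equal to the vertical indices: $\deg f_i=\mathsf v_i(\rho)$ for all $i$.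
   Context: All objects are over $\mathbb C$. Jordan–Kronecker form: for linear maps $A,B:U\to W$ of finite-dimensional spaces there are bases of $U$ and $W$ in which every $A+\lambda B$ is block-diagonal with blocks $A_i+\lambda B_i$ of the following types, the number and types of blocks being unique up to permutation: (1) Jordan block with eigenvalue $\lambda_0\in\mathbb C$: $A_i$ is a square upper triangular Jordan block with eigenvalue $\lambda_0$ and $B_i=-I$; (2) Jordan block with eigenvalue $\infty$: $A_i=I$ and $B_i=-N$, where $N$ is the nilpotent Jordan block; (3) horizontal Kronecker block of size $(h-1)\times h$, $h\ge 1$: $A_i=(0\mid I_{h-1})$, $B_i=-(I_{h-1}\mid 0)$; (4) vertical Kronecker block of size $v\times(v-1)$, $v\ge1$: $A_i=\binom{0}{I_{v-1}}$, $B_i=-\binom{I_{v-1}}{0}$. A zero $m\times n$ block is regarded as $m$ vertical blocks of size $1\times0$ and $n$ horizontal blocks of size $0\times1$. The vertical indices of the pencil are the heights $v$ of its vertical Kronecker blocks. For $x\in V$ let $R_x:\mathfrak g\to V$, $R_x(\xi)=\rho(\xi)x$. There is a non-empty Zariski open set of pairs $(a,b)\in V\times V$ (generic pairs) for which the types and sizes of the blocks of the pencil $R_a+\lambda R_b$ (up to the values of the eigenvalues) are one and the same. The vertical indices of $\rho$ are those of $R_a+\lambda R_b$ for generic $(a,b)$; their number is $\operatorname{codim}\mathcal O_{\mathrm{reg}}:=\dim V-\max_{x\in V}\operatorname{rk}R_x$. A polynomial $f\in\mathbb C[V]$ is an invariant if $df(x)(\rho(\xi)x)=0$ for all $x\in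 V,\xi\in\mathfrak g$; it is a semi-invariant if there is a linear functional $\chi:\mathfrak g\to\mathbb C$ with $df(x)(\rho(\xi)x)=\chi(\xi)f(x)$ for all $x,\xi$.
   Formalization: In item 2 the generators f_1,…,f_q are additionally assumed homogeneous; without this the claim fails, e.g. for the trivial action on C^2 with free generators x, y+x^2 (degrees 1,2, vertical indices 1,1). *)

(* Defs.v *)
From HB Require Import structures.
From mathcomp Require Import all_boot all_order all_algebra.
From mathcomp Require Import reals complex mpoly.

Set Implicit Arguments.
Unset Strict Implicit.
Unset Printing Implicit Defensive.

Import GRing.Theory.
Local Open Scope ring_scope.

Section LieRepresentations.
Variables (K : fieldType) (g V : vectType K).

Definition is_lie_bracket (br : g -> g -> g) : Prop :=
  [/\ forall x, linear (br x),
      forall y, linear (br^~ y),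
      forall x, br x x = 0
    & forall x y z, br x (br y z) + br y (br z x) + br z (br x y) = 0].

Definition is_lie_rep (br : g -> g -> g) (rho : 'Hom(g, 'End(V))) : Prop :=
  forall x y : g,
    rho (br x y) = (rho x \o rho y)%VF - (rho y \o rho x)%VF.

Definition orbit_map (rho : 'Hom(g, 'End(V))) (x : V) : 'Hom(g, V) :=
  linfun (fun xi : g => rho xi x).

Lemma orbit_mapE rho x xi : orbit_map rho x xi = rho xi x.
Proof.
have lin : linear (fun xi : g => rho xi x).
  by move=> a u v; rewrite linearP add_lfunE scale_lfunE.
pose h := GRing.isLinear.Build K g V _ _ lin.
pose phi : {linear g -> V} := HB.pack (fun xi : g => rho xi x) h.
exact: (lfunE phi).
Qed.

Definition is_codim_reg (rho : 'Hom(g, 'End(V))) (q : nat) : Prop :=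
  exists2 x : V,
    forall y : V, (\dim (limg (orbit_map rho y))
                     <= \dim (limg (orbit_map rho x)))%N
    & q = (\dim {:V} - \dim (limg (orbit_map rho x)))%N.

End LieRepresentations.

(* The algebra K[V] is represented by polynomials in the linear coordinates   *)
(* of V attached to the basis vbasis {:V}. Over an infinite field this is the *)
(* algebra of polynomial functions, and total degree, homogeneity and the     *)
(* differential do not depend on the basis.                                   *)
Section PolynomialsOnSpace.
Variables (K : fieldType) (V : vectType K).

Definition vcoord (x : V) : 'I_(\dim {:V}) -> K :=
  fun i => coord (vbasis {:V}) i x.

Definition vpoly := {mpoly K[\dim {:V}]}.

Definition veval (p : vpoly) (x : V) : K := p.@[vcoord x].

(* dp(x)(w) *)
Definition vdiff (p : vpoly) (x w : V) : K :=
  \sum_(i < \dim {:V}) (p^`M(i)).@[vcoord x] * vcoord w i.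

Definition zariski_open (O : V -> Prop) : Prop :=
  exists I : vpoly -> Prop,
    forall x, O x <-> exists2 p, I p & veval p x != 0.

Definition generically (P : V -> Prop) : Prop :=
  exists O : V -> Prop,
    [/\ zariski_open O, exists x, O x & forall x, O x -> P x].

End PolynomialsOnSpace.

(* msize is 1 + the total degree for p != 0, and tdeg 0 = 0. *)
Definition tdeg (K : fieldType) n (p : {mpoly K[n]}) : nat := (msize p).-1.

Definition alg_independent (K : fieldType) n q
    (f : q.-tuple {mpoly K[n]}) : Prop :=
  forall P : {mpoly K[q]}, P \mPo f = 0 -> P = 0.

Definition freely_generates (K : fieldType) n q
    (A : {mpoly K[n]} -> Prop) (f : q.-tuple {mpoly K[n]}) : Prop :=
  alg_independent f /\
  forall h : {mpoly K[n]}, A h <-> exists P : {mpoly K[q]}, h = P \mPo f.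

Section Invariants.
Variables (K : fieldType) (g V : vectType K).
Variable rho : 'Hom(g, 'End(V)).

Definition is_invariant (f : vpoly V) : Prop :=
  forall (x : V) (xi : g), vdiff f x (rho xi x) = 0.

Definition is_semi_invariant (f : vpoly V) : Prop :=
  exists chi : 'Hom(g, K^o),
    forall (x : V) (xi : g), vdiff f x (rho xi x) = chi xi * veval f x.

Definition no_proper_semi_invariants : Prop :=
  forall f : vpoly V, is_semi_invariant f -> is_invariant f.

End Invariants.

(* Sizes are shifted so that no degenerate block occurs:                      *)
(*   JordanBlock k l, JordanInfBlock k  have size k.+1 x k.+1;                *)
(*   HorizontalBlock k                  has size k x k.+1    (h = k.+1);      *)
(*   VerticalBlock k                    has size k.+1 x k    (v = k.+1).      *)
Inductive jk_block (K : Type) :=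
  | JordanBlock of nat & K
  | JordanInfBlock of nat
  | HorizontalBlock of nat
  | VerticalBlock of nat.

Arguments JordanInfBlock {K}.
Arguments HorizontalBlock {K}.
Arguments VerticalBlock {K}.

Section JordanKronecker.
Variable K : fieldType.

Definition jk_rows (b : jk_block K) : nat :=
  match b with
  | JordanBlock k _ | JordanInfBlock k | VerticalBlock k => k.+1
  | HorizontalBlock k => k
  end.

Definition jk_cols (b : jk_block K) : nat :=
  match b with
  | JordanBlock k _ | JordanInfBlock k | HorizontalBlock k => k.+1
  | VerticalBlock k => k
  end.

Definition jk_A (b : jk_block K) : 'M[K]_(jk_rows b, jk_cols b) :=
  \matrix_(i, j)
    match b with
    | JordanBlock _ l => l *+ (i == j :> nat) + (j == i.+1 :> nat)%:R
    | JordanInfBlock _ => (i == j :> nat)%:R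
    | HorizontalBlock _ => (j == i.+1 :> nat)%:R
    | VerticalBlock _ => (i == j.+1 :> nat)%:R
    end.

Definition jk_B (b : jk_block K) : 'M[K]_(jk_rows b, jk_cols b) :=
  \matrix_(i, j)
    match b with
    | JordanInfBlock _ => - (j == i.+1 :> nat)%:R
    | _ => - (i == j :> nat)%:R
    end.

Fixpoint total (d : jk_block K -> nat) (bs : seq (jk_block K)) : nat :=
  if bs is b :: bs' then d b + total d bs' else 0.

Fixpoint block_diag (M : forall b, 'M[K]_(jk_rows b, jk_cols b))
    (bs : seq (jk_block K)) : 'M[K]_(total jk_rows bs, total jk_cols bs) :=
  if bs is b :: bs' then block_mx (M b) 0 0 (block_diag M bs') else 0.

Definition matrix_in_bases (U W : vectType K) m n
    (u : m.-tuple U) (w : n.-tuple W) (A : 'Hom(U, W)) : 'M[K]_(n, m) :=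
  \matrix_(i, j) coord w i (A (tnth u j)).

Definition jk_form (U W : vectType K) (A B : 'Hom(U, W))
    (bs : seq (jk_block K)) : Prop :=
  exists (u : (total jk_cols bs).-tuple U) (w : (total jk_rows bs).-tuple W),
    [/\ basis_of fullv u, basis_of fullv w,
        matrix_in_bases u w A = block_diag jk_A bs
      & matrix_in_bases u w B = block_diag jk_B bs].

Definition jk_type (b : jk_block K) : jk_block unit :=
  match b with
  | JordanBlock k _ => JordanBlock k tt
  | JordanInfBlock k => JordanInfBlock k
  | HorizontalBlock k => HorizontalBlock k
  | VerticalBlock k => VerticalBlock k
  end.

End JordanKronecker.

Definition vertical_heights (ts : seq (jk_block unit)) : seq nat :=
  pmap (fun t => if t is VerticalBlock k then Some k.+1 else None) ts.

(* v lists the vertical indices of rho in nondecreasing order. Blocks may be  *)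
(* permuted freely in a Jordan-Kronecker form, so requiring one and the same  *)
(* sequence ts of block types for all generic pairs loses no generality.      *)
Definition vertical_indices (K : fieldType) (g V : vectType K)
    (rho : 'Hom(g, 'End(V))) (v : seq nat) : Prop :=
  exists ts : seq (jk_block unit),
    generically (fun ab : (V * V)%type =>
      exists2 bs : seq (jk_block K),
        jk_form (orbit_map rho ab.1) (orbit_map rho ab.2) bs
        & [seq jk_type b | b <- bs] = ts)
    /\ v = sort leq (vertical_heights ts).

(* Main.v *)
Require Import Defs.
From HB Require Import structures.
From mathcomp Require Import all_boot all_order all_algebra.
From mathcomp Require Import perm ring zify boolp reals complex mpoly.

(** Write n = dim V. For x = a + t b on a line of V, the differential of an
    invariant h at x vanishes on the image of R_x = R_a + t R_b, so dh(a + t b) is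
    an element of the left kernel, over K[t], of the pencil R_a + t R_b. By the
    Jordan-Kronecker form this kernel is spanned by q rows Phi_j of degrees
    v_j - 1, and the coordinates of a kernel row on the Phi_j are some of its
    entries in a suitable basis of V [jk_form_kernel]. For invariants f_i of
    degrees d_i let G be the square matrix of the coordinates of the rows
    df_i(a + t b), and call minors of f the polynomials det (Jac(f) N), where N is
    a constant n x q matrix: det G is the restriction of a minor to the line.
    Everything follows from two readings of det G.

    - For algebraically independent f_i some minor is nonzero
      [jacobian_criterion], so det G is nonzero on a generic line. A nonzero term
      of det G matches each f_i with some j such that v_j <= d_i, whence
      v_i <= d_i after sorting [vertical_index_le]; equal sums then force equal
      families.

    - The degree of det G is at most the sum of the d_i - v_j. When this is 0,
      det G is a nonzero constant, so the df_i are independent at every point of a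
      generic line. Such a line meets every hypersurface, hence no prime divides
      all minors [minors_coprime].

    Sufficiency. Given an invariant h, dh = sum c_i df_i with rational functions
    c_i, and these are polynomials because the minors have no common factor. By
    the symmetry of the Hessian of h, the dc_i are again combinations of the df_j.
    Hence, by induction on the degree, c_i = C_i(f); the form sum C_i dy_i is
    closed, and its primitive H satisfies h = H(f) up to a constant
    [generated_by_tuple].

    Necessity. If the f_i are homogeneous and sum d_i > sum v_i, then det G has a
    root on a generic line, and all minors vanish there; as polynomials without
    common factor have no common zero on a generic line [common_zeros_codim2],
    some prime p divides all minors. The Lie algebra preserves the span of the
    minors, so it maps p to multiples of p [prime_divides_field]: p is a
    semi-invariant, hence an invariant, hence p = P(f). The relations among the f_i
    modulo p are the multiples of P, because the invariants are K[f]
    [relations_modulo_invariant]. The Jacobian criterion on the hypersurface p = 0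
    then says that the df_i are independent at its generic point, which
    contradicts the choice of p.

    Genericity is used in the form: finitely many nonzero polynomial functions
    have a common point of nonvanishing. Unique factorization in K[x_1, ..., x_n]
    is proved first. *)

Set Implicit Arguments.
Unset Strict Implicit.
Unset Printing Implicit Defensive.

Import GRing.Theory.
Local Open Scope ring_scope.

(** * Unique factorization in polynomial rings *)

Definition divides (R : comNzRingType) (a b : R) : Prop := exists c, b = c * a.

Definition prime_elt (R : idomainType) (p : R) : Prop :=
  [/\ p != 0, ~ divides p 1
    & forall a b, divides p (a * b) -> divides p a \/ divides p b].

Inductive factorial (R : idomainType) : R -> Prop :=
  | FactorialUnit u : u \is a GRing.unit -> factorial u
  | FactorialMul p a : prime_elt p -> factorial a -> factorial (p * a).

Definition ufd (R : idomainType) : Prop := forall a : R, a != 0 -> factorial a.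

Section Divides.
Variable R : comNzRingType.
Implicit Types a b c : R.

Lemma dividesxx a : divides a a.
Proof. by exists 1; rewrite mul1r. Qed.

Lemma divides_mull a b c : divides a b -> divides a (c * b).
Proof. by case=> d ->; exists (c * d); rewrite mulrA. Qed.

Lemma divides_mulr a b c : divides a b -> divides a (b * c).
Proof. by rewrite mulrC; apply: divides_mull. Qed.

Lemma divides0 a : divides a 0.
Proof. by exists 0; rewrite mul0r. Qed.

Lemma dividesD a b c : divides a b -> divides a c -> divides a (b + c).
Proof. by move=> [x ->] [y ->]; exists (x + y); rewrite mulrDl. Qed.

Lemma dividesN a b : divides a b -> divides a (- b).
Proof. by move=> [x ->]; exists (- x); rewrite mulNr. Qed.

Lemma dividesB a b c : divides a b -> divides a c -> divides a (b - c).
Proof. by move=> ab /dividesN; apply: dividesD. Qed.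

Lemma divides_sum a (I : Type) (r : seq I) (P : pred I) (F : I -> R) :
  (forall i, P i -> divides a (F i)) -> divides a (\sum_(i <- r | P i) F i).
Proof.
by move=> aF; apply: big_ind; [exact: divides0 | exact: dividesD | exact: aF].
Qed.

Lemma divides_trans a b c : divides a b -> divides b c -> divides a c.
Proof. by move=> [x ->] [y ->]; exists (y * x); rewrite mulrA. Qed.

End Divides.

Lemma divides_rmorph (R S : comNzRingType) (f : {rmorphism R -> S}) a b :
  divides a b -> divides (f a) (f b).
Proof. by case=> c ->; exists (f c); rewrite rmorphM. Qed.

Section PrimeElements.
Variable R : idomainType.
Implicit Types a b p q u : R.

Lemma prime_not_unit p u : prime_elt p -> u \is a GRing.unit -> ~ divides p u.
Proof.
by case=> _ p1 _ uu pu; apply: p1; rewrite -(mulVr uu); apply: divides_mull.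
Qed.

Lemma prime_factorial p : prime_elt p -> factorial p.
Proof.
by move=> pp; rewrite -[p]mulr1; apply: FactorialMul => //; apply: FactorialUnit;
  exact: unitr1.
Qed.

Lemma factorialM a b : factorial a -> factorial b -> factorial (a * b).
Proof.
move=> fa fb; elim: fa => [u uu|p c pp _ IH]; last first.
  by rewrite -mulrA; apply: FactorialMul.
elim: fb u uu => [v vv u uu|p c pp _ IH u uu].
  by apply: FactorialUnit; rewrite unitrM uu vv.
by rewrite mulrCA; apply: FactorialMul => //; apply: IH.
Qed.

Lemma prime_associate p q : prime_elt p -> prime_elt q ->
  divides q p -> divides p q.
Proof.
move=> pp pq [c def_p]; have [p0 _ pM] := pp; have [_ q1 _] := pq.
have: divides p (c * q) by rewrite -def_p; apply: dividesxx.
case/pM => // -[d def_c]; case: q1; exists d.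
apply: (mulIf p0); rewrite mul1r {1}def_p def_c; ring.
Qed.

(** A common divisor of a family can be cancelled from a proportionality between
    two families as soon as no prime divides the whole second family. *)
Lemma factorial_cancel (I : Type) (E F : I -> R) a b : factorial b ->
  (forall p, prime_elt p -> exists i, ~ divides p (E i)) ->
  (forall i, a * E i = b * F i) -> divides b a.
Proof.
move=> fb cop; elim: fb a => [u uu a _|p c pp _ IH a eqEF].
  by exists (a * u^-1); rewrite mulrVK.
have [i piE] := cop p pp; have [p0 _ pM] := pp.
have: divides p (a * E i).
  by rewrite eqEF -mulrA; apply: divides_mulr; apply: dividesxx.
case/pM => // -[a' def_a].
have: divides c a'.
  apply: IH => j; apply: (mulfI p0).
  by rewrite !mulrA (mulrC p a') -def_a eqEF.
by case=> d def_a'; exists d; rewrite def_a def_a' -!mulrA (mulrC c).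
Qed.

End PrimeElements.

Section Gauss.
Variable R : idomainType.
Hypothesis ufdR : ufd R.
Implicit Types (p c : R) (f g h : {poly R}).

Lemma dividesCP p f : divides p%:P f <-> forall i, divides p f`_i.
Proof.
split=> [[g ->] i|pf]; first by rewrite coefMC; exists g`_i.
have [g gP] := choice pf.
exists (\poly_(i < size f) g i); apply/polyP => i.
rewrite coefMC coef_poly; case: ltnP => [_|szi]; first exact: gP.
by rewrite nth_default // mul0r.
Qed.

(** If p divides neither f nor g, then in the product of the lowest coefficients
    of f and g outside (p) everything else is absorbed by p. *)
Lemma prime_polyC p : prime_elt p -> prime_elt p%:P.
Proof.
move=> pp; have [p0 p1 pM] := pp; split=> [||f g pfg].
- by rewrite polyC_eq0.
- by move/dividesCP/(_ 0); rewrite coef1.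
case: (EM (divides p%:P f)) => [|nf]; first by left.
case: (EM (divides p%:P g)) => [|ng]; first by right.
have low h : ~ divides p%:P h ->
    exists2 i, ~ divides p h`_i & forall j, (j < i)%N -> divides p h`_j.
  move/dividesCP/existsNP => [i0 pi0].
  have exi : exists i, `[< ~ divides p h`_i >] by exists i0; apply/asboolP.
  case: (ex_minnP exi) => i /asboolP npi imin; exists i => // j ji.
  apply: contrapT => npj; have := imin j; rewrite leqNgt ji => jmin.
  by have := jmin (introT (asboolP _) npj).
have [i npi ilow] := low f nf; have [j npj jlow] := low g ng.
have/dividesCP/(_ (i + j)%N) := pfg.
rewrite coefM (bigD1 (inord i)) //= inordK ?ltnS ?leq_addr // addKn => pS.
have: divides p (f`_i * g`_j).
  rewrite -[_ * _](addrK (\sum_(k < (i + j).+1 | k != inord i)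
                            f`_k * g`_(i + j - k))).
  apply: dividesB => //; apply: divides_sum => k /eqP neki.
  case: (ltngtP k i) => [ki|ik|eki].
  - by apply: divides_mulr; apply: ilow.
  - apply: divides_mull; apply: jlow; have := ltn_ord k; lia.
  - by case: neki; apply: val_inj; rewrite /= inordK ?ltnS ?leq_addr.
by case/pM.
Qed.

Lemma factorial_polyC c : factorial c -> factorial c%:P.
Proof.
elim=> [u uu|p a pp _ IH]; first by apply: FactorialUnit; rewrite rmorph_unit.
by rewrite polyCM; apply: FactorialMul => //; apply: prime_polyC.
Qed.

Definition primitive f := forall p, prime_elt p -> ~ divides p%:P f.

(** The primes of the leading coefficient are tried one after the other. *)
Lemma primitive_part f : f != 0 ->
  exists c f0, [/\ f = c%:P * f0, c != 0 & primitive f0].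
Proof.
move=> f0; have lf : lead_coef f != 0 by rewrite lead_coef_eq0.
(* e collects the primes of the leading coefficient found not to divide f *)
suff gen l : factorial l -> forall e f, f != 0 ->
    (forall r, prime_elt r -> divides r%:P f -> ~ divides r e) ->
    divides (lead_coef f) (e * l) ->
    exists c f0, [/\ f = c%:P * f0, c != 0 & primitive f0].
  apply: (gen _ (ufdR lf) 1) => //; last by rewrite mul1r; apply: dividesxx.
  by move=> r [].
have lead r g : divides r%:P g -> divides r (lead_coef g).
  by move/dividesCP; apply.
elim=> [u uu|p a pp _ IH] e {lf}{}f {}f0 fe lfe.
  exists 1, f; rewrite mul1r oner_eq0; split=> // r pr rf; have [_ _ rM] := pr.
  have/rM[] := divides_trans (lead _ _ rf) lfe; first exact: fe.
  exact: prime_not_unit.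
have [p0 _ pM] := pp.
case: (EM (divides p%:P f)) => [[g def_f]|npf].
  have g0 : g != 0 by apply: contraNneq f0 => g0; rewrite def_f g0 mul0r.
  have [||c [f' [def_g c0 prf']]] := IH e g g0.
  - by move=> r pr rg; apply: fe => //; rewrite def_f; apply: divides_mulr.
  - case: lfe => d lfe; exists d; apply: (mulIf p0).
    rewrite -mulrA (mulrC a) lfe def_f lead_coefM lead_coefC; ring.
  exists (c * p), f'; rewrite mulf_neq0 // polyCM def_f def_g; split=> //; ring.
apply: (IH (e * p)) => //; last by rewrite -mulrA.
move=> r pr rf; have [_ _ rM] := pr => /rM[]; first exact: fe.
move/(prime_associate pp pr) => prr; apply: npf.
by apply: divides_trans rf; apply: (divides_rmorph polyC).
Qed.

(** Each prime factor of d divides g or h, so it can be cancelled there. *)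
Lemma factor_clear d : factorial d -> forall f g h, d%:P * f = g * h ->
  exists g' h', [/\ f = g' * h', size g' = size g & size h' = size h].
Proof.
elim=> [u uu|p a pp _ IH] f g h.
  move=> eqf; exists (u^-1%:P * g), h; split=> //; last first.
    by rewrite mul_polyC size_scale // invr_eq0; apply: contraTneq uu => ->;
      rewrite unitr0.
  by rewrite -mulrA -eqf mulrA -polyCM mulVr // mul1r.
have [p0 _ pM] := prime_polyC pp; have pC0 : p != 0 by have [] := pp.
rewrite polyCM => eqf; have: divides p%:P (g * h).
  by rewrite -eqf -mulrA; apply: divides_mulr; apply: dividesxx.
have szC k : size (k * p%:P) = size k by rewrite mulrC mul_polyC size_scale.
case/pM => -[k def_k].
  have [|g' [h' [-> sg sh]]] := IH f k h.
    by apply: (mulIf p0); transitivity (g * h); [rewrite -eqf | rewrite def_k]; ring.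
  by exists g', h'; rewrite def_k szC.
have [|g' [h' [-> sg sh]]] := IH f g k.
  by apply: (mulIf p0); transitivity (g * h); [rewrite -eqf | rewrite def_k]; ring.
by exists g', h'; rewrite def_k szC.
Qed.

Lemma primitive_dvdp f g : primitive f -> Pdiv.Idomain.dvdp f g -> divides f g.
Proof.
move=> prf; case/Pdiv.Idomain.dvdpP => -[c k] /= c0.
rewrite -mul_polyC; elim: (ufdR c0) g k => [u uu|p a pp _ IH] g k.
  move=> eqg; exists (u^-1%:P * k).
  by rewrite -mulrA -eqg mulrA -polyCM mulVr // mul1r.
have [p0 _ pM] := prime_polyC pp.
rewrite polyCM => eqg; have: divides p%:P (k * f).
  by rewrite -eqg -mulrA; apply: divides_mulr; apply: dividesxx.
case/pM => [[k' def_k]|/prf//].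
apply: (IH g k'); apply: (mulIf p0); transitivity (k * f); [rewrite -eqg | rewrite def_k]; ring.
Qed.

(** For a primitive polynomial, divisibility over R and over the fraction field
    agree; so irreducibility, tested by a pseudo-gcd, gives primality. *)
Lemma irreducible_prime f : primitive f -> (1 < size f)%N ->
  (forall g h, f = g * h -> size g = 1 \/ size h = 1) -> prime_elt f.
Proof.
move=> prf szf irr; have f0 : f != 0 by rewrite -size_poly_gt0 ltnW.
split=> [//||g h fgh].
  case=> c /(congr1 (fun p : {poly R} => size p)); rewrite size_poly1.
  have [->|c0] := eqVneq c 0; first by rewrite mul0r size_poly0.
  rewrite size_mul //; move: szf; rewrite -(size_poly_gt0 c) in c0.
  lia.
pose d := Pdiv.Idomain.gcdp f g.
have fd : Pdiv.Idomain.dvdp f (g * h).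
  by case: fgh => c ->; rewrite Pdiv.Idomain.dvdp_mull // Pdiv.Idomain.dvdpp.
have df : Pdiv.Idomain.dvdp d f by apply: Pdiv.Idomain.dvdp_gcdl.
case/Pdiv.Idomain.dvdpP: (df) => -[c k] /= c0; rewrite -mul_polyC => eqf.
have [k' [d' [def_f szk szd]]] := factor_clear (ufdR c0) eqf.
case: (irr _ _ def_f) => sz1; last first.
  right; apply: primitive_dvdp => //.
  by rewrite -(Pdiv.Idomain.Gauss_dvdpr _ (d := f) (q := g)) // /Pdiv.Idomain.coprimep
    -/d -szd sz1.
left; apply: primitive_dvdp => //.
have/Pdiv.Idomain.eqp_dvdl <- : Pdiv.Idomain.eqp d f.
  rewrite -Pdiv.Idomain.dvdp_size_eqp // -szd def_f.
  have k'0 : k' != 0 by apply: contraNneq f0 => z; rewrite def_f z mul0r.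
  have d'0 : d' != 0 by apply: contraNneq f0 => z; rewrite def_f z mulr0.
  by rewrite size_mul // sz1.
exact: Pdiv.Idomain.dvdp_gcdr.
Qed.

Lemma ufd_poly : ufd {poly R}.
Proof.
move=> f; have [n] := ubnP (size f); elim: n f => // n IH f szf f0.
have [c [g [def_f c0 prg]]] := primitive_part f0.
have g0 : g != 0 by apply: contraNneq f0 => z; rewrite def_f z mulr0.
have szg : size f = size g by rewrite def_f mul_polyC size_scale.
rewrite def_f; apply: factorialM; first exact: factorial_polyC (ufdR c0).
have [sg1|sg1] := leqP (size g) 1.
  by rewrite (size1_polyC sg1); apply: factorial_polyC; apply: ufdR;
    rewrite -polyC_eq0 -size1_polyC.
case: (EM (exists a b, [/\ g = a * b, size a <> 1 & size b <> 1])).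
  case=> a [b [def_g sa sb]].
  have a0 : a != 0 by apply: contraNneq g0 => z; rewrite def_g z mul0r.
  have b0 : b != 0 by apply: contraNneq g0 => z; rewrite def_g z mulr0.
  have := size_mul a0 b0; rewrite -def_g.
  move: (a0) (b0); rewrite -!size_poly_gt0 => pa pb sab.
  by rewrite def_g; apply: factorialM; apply: IH => //; lia.
move=> irr; apply: prime_factorial; apply: irreducible_prime => // a b def_g.
case: (eqVneq (size a) 1) => [|/eqP sa]; first by left.
case: (eqVneq (size b) 1) => [|/eqP sb]; first by right.
by case: irr; exists a, b.
Qed.

End Gauss.

Section RingMorphisms.

Lemma mpoly_rmorph_eq n (R S : comNzRingType)
    (phi psi : {rmorphism {mpoly R[n]} -> S}) :
  (forall c, phi c%:MP = psi c%:MP) -> (forall i, phi 'X_i = psi 'X_i) ->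
  phi =1 psi.
Proof.
move=> eqC eqX p; rewrite (mpolyE p) !rmorph_sum; apply: eq_bigr => m _.
rewrite -mul_mpolyC !rmorphM eqC; congr (_ * _).
rewrite mpolyXE_id !rmorph_prod; apply: eq_bigr => i _.
by rewrite !rmorphXn eqX.
Qed.

Lemma poly_rmorph_eq (R S : nzRingType) (phi psi : {rmorphism {poly R} -> S}) :
  (forall c, phi c%:P = psi c%:P) -> phi 'X = psi 'X -> phi =1 psi.
Proof.
move=> eqC eqX p; rewrite -(coefK p) poly_def !rmorph_sum; apply: eq_bigr => i _.
by rewrite -mul_polyC !rmorphM eqC !rmorphXn eqX.
Qed.

End RingMorphisms.

Section TransferPrimes.
Variables (R S : idomainType) (f : {rmorphism R -> S}) (g : {rmorphism S -> R}).
Hypotheses (fK : cancel f g) (gK : cancel g f).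

Lemma divides_iso a b : divides (f a) (f b) <-> divides a b.
Proof.
split; last exact: divides_rmorph.
by move/(divides_rmorph g); rewrite !fK.
Qed.

Lemma prime_iso p : prime_elt p -> prime_elt (f p).
Proof.
case=> p0 p1 pM; split=> [||a b].
- by rewrite -(rmorph0 f) (inj_eq (can_inj fK)).
- by rewrite -(rmorph1 f) divides_iso.
- by rewrite -[a]gK -[b]gK -rmorphM !divides_iso; apply: pM.
Qed.

Lemma factorial_iso a : factorial a -> factorial (f a).
Proof.
elim=> [u uu|p b pp _ IH]; first by apply: FactorialUnit; rewrite rmorph_unit.
by rewrite rmorphM; apply: FactorialMul => //; apply: prime_iso.
Qed.

End TransferPrimes.

Section LastVariable.
Variables (R : comNzRingType) (n : nat).

Definition split_last : {mpoly R[n.+1]} -> {poly {mpoly R[n]}} :=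
  mmap (polyC \o @mpolyC n R)
    (fun i => if unlift ord_max i is Some j then ('X_j)%:P else 'X).

Definition widen_last : {mpoly R[n]} -> {mpoly R[n.+1]} :=
  mmap (@mpolyC n.+1 R) (fun j => 'X_(lift ord_max j)).

Definition merge_last : {poly {mpoly R[n]}} -> {mpoly R[n.+1]} :=
  horner_eval 'X_ord_max \o map_poly widen_last.

HB.instance Definition _ := GRing.RMorphism.on split_last.
HB.instance Definition _ := GRing.RMorphism.on widen_last.
HB.instance Definition _ := GRing.RMorphism.on merge_last.

Lemma split_lastK : cancel split_last merge_last.
Proof.
pose phi := [the {rmorphism {mpoly R[n.+1]} -> {mpoly R[n.+1]}}
              of merge_last \o split_last].
move=> p; apply: (mpoly_rmorph_eq (phi := phi) (psi := idfun)) => [c|i] /=.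
  by rewrite /split_last mmapC /= /merge_last /= map_polyC /= /horner_eval hornerC
    /widen_last mmapC.
rewrite /split_last mmapX mmap1U /merge_last /=; case: unliftP => [j|] ->.
  by rewrite map_polyC /horner_eval hornerC /= /widen_last mmapX mmap1U.
by rewrite map_polyX /horner_eval hornerX.
Qed.

Lemma merge_lastK : cancel merge_last split_last.
Proof.
pose phi := [the {rmorphism {poly {mpoly R[n]}} -> {poly {mpoly R[n]}}}
              of split_last \o merge_last].
have mC c : merge_last c%:P = widen_last c.
  by rewrite /merge_last /= map_polyC /horner_eval hornerC.
move=> p; apply: (poly_rmorph_eq (phi := phi) (psi := idfun)) => [c|] /=; last first.
  rewrite /merge_last /= map_polyX /horner_eval hornerX /split_last mmapX mmap1U.
  by rewrite unlift_none.
rewrite mC; pose chi := [the {rmorphism {mpoly R[n]} -> {poly {mpoly R[n]}}}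
                          of split_last \o widen_last].
apply: (mpoly_rmorph_eq (phi := chi) (psi := polyC)) => [d|i] /=.
  by rewrite /widen_last mmapC /split_last mmapC.
by rewrite /widen_last mmapX mmap1U /split_last mmapX mmap1U liftK.
Qed.

End LastVariable.

Lemma ufd_mpoly (K : fieldType) n : ufd {mpoly K[n]}.
Proof.
elim: n => [|n IH] p p0.
  apply: FactorialUnit; move: p0; rewrite [p]nvar0_mpolyC mpolyC_eq0 => p0.
  by rewrite rmorph_unit // unitfE.
have := ufd_poly IH; move/(_ (split_last p)); rewrite -(rmorph0 (@split_last K n)).
rewrite (inj_eq (can_inj (@split_lastK K n))) => /(_ p0).
move/(factorial_iso (@merge_lastK K n) (@split_lastK K n)).
by rewrite /= split_lastK.
Qed.

(** * Polynomials: evaluation, lines, differentials *)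

Section MPolyInduction.
Variables (R : comNzRingType) (n : nat).

Lemma mpoly_ring_ind (P : {mpoly R[n]} -> Prop) :
  (forall c, P c%:MP) -> (forall i, P 'X_i) ->
  (forall p q, P p -> P q -> P (p + q)) ->
  (forall p q, P p -> P q -> P (p * q)) -> forall p, P p.
Proof.
move=> PC PX PD PM p; rewrite (mpolyE p); apply: (big_ind P) => [|//|m _].
  by rewrite -mpolyC0.
rewrite -mul_mpolyC; apply: (PM) => //; rewrite mpolyXE_id.
apply: (big_ind P) => [|x y|i _]; [by rewrite -mpolyC1 | exact: PM |].
elim: (m i) => [|k IH]; first by rewrite expr0 -mpolyC1.
by rewrite exprS; apply: PM.
Qed.

End MPolyInduction.

Section Evaluation.
Variable K : numFieldType.

Lemma poly_nonroot (P : {poly K}) : P != 0 -> exists t, P.[t] != 0.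
Proof.
move=> P0; apply: contrapT => nt.
have allr : all (root P) [seq i%:R | i <- iota 0 (size P)].
  apply/allP => x _; apply: contrapT => /negP nr; apply: nt.
  by exists x; rewrite -rootE.
have uni : uniq [seq i%:R : K | i <- iota 0 (size P)].
  rewrite map_inj_uniq ?iota_uniq // => i j /eqP.
  by rewrite Num.Theory.eqr_nat => /eqP.
by have := max_poly_roots P0 allr uni; rewrite size_map size_iota ltnn.
Qed.

Lemma mpoly_nonroot n (p : {mpoly K[n]}) : p != 0 -> exists x, p.@[x] != 0.
Proof.
elim: n p => [|n IH] p p0.
  exists (fun _ => 0); move: p0; rewrite [p]nvar0_mpolyC mpolyC_eq0.
  by rewrite mevalC.
have P0 : split_last p != 0.
  by rewrite -(rmorph0 (@split_last K n)) (inj_eq (can_inj (@split_lastK K n))).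
have /IH [x cx] : lead_coef (split_last p) != 0 by rewrite lead_coef_eq0.
have /poly_nonroot [t nt] : map_poly (meval x) (split_last p) != 0.
  apply: contraNneq cx => eq0; rewrite lead_coefE -coef_map eq0.
  by rewrite coef0.
exists (fun i => if unlift ord_max i is Some j then x j else t).
set y := fun _ => _; suff -> : p.@[y] = (map_poly (meval x) (split_last p)).[t].
  by [].
pose phi := [the {rmorphism {mpoly K[n.+1]} -> K} of
  horner_eval t \o map_poly (meval x) \o split_last (n := n)].
apply: (mpoly_rmorph_eq (phi := meval y) (psi := phi)) => [c|i] /=.
  by rewrite /split_last mmapC /= map_polyC /horner_eval hornerC mevalC /= mevalC.
rewrite /split_last mmapX mmap1U mevalXU /y; case: (unlift ord_max i) => [j|].
  by rewrite map_polyC /horner_eval hornerC /= mevalXU.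
by rewrite map_polyX /horner_eval hornerX.
Qed.

End Evaluation.

Section Lines.
Variables (K : fieldType) (n : nat).
Implicit Types (a b : 'I_n -> K) (p : {mpoly K[n]}).

Definition on_line a b : {mpoly K[n]} -> {poly K} :=
  mmap polyC (fun i => (a i)%:P + (b i)%:P * 'X).

HB.instance Definition _ a b := GRing.RMorphism.on (on_line a b).

Lemma on_lineC a b c : on_line a b c%:MP = c%:P.
Proof. by rewrite /on_line mmapC. Qed.

Lemma on_lineE a b p t : (on_line a b p).[t] = p.@[fun i => a i + t * b i].
Proof.
pose phi := [the {rmorphism {mpoly K[n]} -> K} of horner_eval t \o on_line a b].
apply: (mpoly_rmorph_eq (phi := phi) (psi := meval _)) => [c|i] /=.
  by rewrite /on_line mmapC mevalC /horner_eval hornerC.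
rewrite /on_line mmapX mmap1U mevalXU /horner_eval.
by rewrite !hornerE mulrC.
Qed.

Lemma coef_top_mul (R : nzRingType) (P Q : {poly R}) d e :
  (size P <= d.+1)%N -> (size Q <= e.+1)%N ->
  (size (P * Q)%R <= (d + e).+1)%N /\ (P * Q)`_(d + e) = P`_d * Q`_e.
Proof.
move=> sP sQ; split.
  by apply: leq_trans (size_polyMleq _ _) _; lia.
have lt_d : (d < (d + e).+1)%N by rewrite ltnS leq_addr.
rewrite coefM (bigD1 (Ordinal lt_d)) //= addKn big1 ?addr0 // => i ne_id.
have [lt_id|le_di] := ltnP i d.
  by rewrite [Q`_ _]nth_default ?mulr0 //; apply: leq_trans sQ _; lia.
rewrite [P`_ _]nth_default ?mul0r //; apply: leq_trans sP _.
by move: ne_id; rewrite -val_eqE /=; lia.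
Qed.

Lemma coef_top_prod (R : comNzRingType) (I : Type) (r : seq I)
    (P : I -> {poly R}) (d : I -> nat) :
  (forall i, (size (P i) <= (d i).+1)%N) ->
  (size (\prod_(i <- r) P i)%R <= (\sum_(i <- r) d i).+1)%N /\
  (\prod_(i <- r) P i)`_(\sum_(i <- r) d i) = \prod_(i <- r) (P i)`_(d i).
Proof.
move=> sP; elim: r => [|i r [IHs IHc]].
  by rewrite !big_nil size_poly1 coef1.
by rewrite !big_cons; have [-> ->] := coef_top_mul (sP i) IHs; rewrite IHc.
Qed.

(** On the line a + t b a monomial of degree d has t-degree at most d, and its
    coefficient at t ^+ d is its value at the direction b. *)
Lemma on_line_monomial a b (m : 'X_{1..n}) :
  (size (on_line a b 'X_[m]) <= (mdeg m).+1)%N /\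
  (on_line a b 'X_[m])`_(mdeg m) = 'X_[m].@[b].
Proof.
have s1 i : (size ((a i)%:P + (b i)%:P * 'X)%R <= 2)%N.
  apply: leq_trans (size_polyD _ _) _; rewrite geq_max.
  rewrite (leq_trans (size_polyC_leq1 _)) //.
  rewrite (leq_trans (size_polyMleq _ _)) // size_polyX addn2 /=.
  by rewrite (leq_ltn_trans (size_polyC_leq1 _)).
have c1 i : ((a i)%:P + (b i)%:P * 'X)`_1 = b i.
  by rewrite coefD coefC coefCM coefX mulr1 add0r.
rewrite /on_line mmapX /mmap1 mevalX mdegE.
have sX i : (size (((a i)%:P + (b i)%:P * 'X) ^+ m i)%R <= (m i).+1)%N /\
    (((a i)%:P + (b i)%:P * 'X) ^+ m i)`_(m i) = b i ^+ m i.
  elim: (m i) => [|k [IHs IHc]]; first by rewrite !expr0 size_poly1 coef1.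
  rewrite !exprS; have [] := coef_top_mul (s1 i) IHs.
  by rewrite add1n => -> ->; rewrite IHc c1.
have [-> ->] := coef_top_prod (index_enum 'I_n) (fun i => (sX i).1).
by split=> //; apply: eq_bigr => i _; rewrite (sX i).2.
Qed.

Lemma size_on_line a b p : (size (on_line a b p) <= msize p)%N.
Proof.
rewrite {1}(mpolyE p) rmorph_sum; apply: leq_trans (size_sum _ _ _) _.
apply/bigmax_leqP_seq => m mp _; rewrite -mul_mpolyC rmorphM.
rewrite /= on_lineC mul_polyC; apply: leq_trans (size_scale_leq _ _) _.
apply: leq_trans (on_line_monomial a b m).1 _.
exact: msize_mdeg_lt.
Qed.

Lemma on_line_homog a b d p : p \is d.-homog -> (on_line a b p)`_d = p.@[b].
Proof.
move=> /dhomogP hp; rewrite [in RHS](mpolyE p) [in LHS](mpolyE p).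
rewrite !rmorph_sum coef_sum; apply: eq_big_seq => m mp /=; rewrite mevalZ -mul_mpolyC rmorphM.
by rewrite /= on_lineC coefCM -(hp m mp) (on_line_monomial a b m).2.
Qed.

End Lines.

Lemma mderiv_var (K : fieldType) n (i j : 'I_n) : ('X_i : {mpoly K[n]})^`M(j) = (i == j)%:R.
Proof.
rewrite mderivX mnm1E; case: eqP => [->|_]; last by rewrite scale0r.
by rewrite scale1r -{1}[U_(j)%MM]add0m addmK mpolyX0.
Qed.

Section Differentials.
Variables (K : numFieldType) (n : nat).
Implicit Types p : {mpoly K[n]}.

Lemma msize_mderiv p k d : (msize p <= d.+2)%N -> (msize p^`M(k) <= d.+1)%N.
Proof.
move=> sp; rewrite msizeE; apply/bigmax_leqP_seq => m + _.
rewrite mcoeff_msupp mcoeff_mderiv; apply: contraNleq => lt_dm.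
rewrite memN_msupp_eq0 ?mul0rn //; apply: msize_mdeg_ge.
by rewrite mdegD mdeg1 addn1; apply: leq_trans sp _.
Qed.

Lemma mderiv_homog p k d : p \is d.-homog -> p^`M(k) \is d.-1.-homog.
Proof.
move=> hp; apply/dhomogP => m; rewrite mcoeff_msupp mcoeff_mderiv => nz.
have mp : (m + U_(k))%MM \in msupp p.
  by rewrite mcoeff_msupp; apply: contraNneq nz => ->; rewrite mul0rn.
by have /= := dhomog_mf hp mp; rewrite mdegD mdeg1 addn1 => <-.
Qed.

Lemma mderiv_eq0_const p : (forall k, p^`M(k) = 0) -> p = (p@_0%MM)%:MP.
Proof.
move=> dp0; apply/mpolyP => m; rewrite mcoeffC.
have [->|] := eqVneq m 0%MM; rewrite ?mulr1 // mulr0.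
rewrite -mdeg_eq0 mdegE sum_nat_eq0 negb_forall => /existsP /= [k mk].
have lem : (U_(k) <= m)%MM by rewrite lep1mP.
have/mpolyP/(_ (m - U_(k))%MM) := dp0 k; rewrite mcoeff_mderiv mcoeff0 submK //.
by move/eqP; rewrite -mulr_natr mulf_eq0 Num.Theory.pnatr_eq0 orbF => /eqP.
Qed.

Lemma mderiv_comp (q : nat) (P : {mpoly K[q]}) (f : q.-tuple {mpoly K[n]}) k :
  (P \mPo f)^`M(k) = \sum_j (P^`M(j) \mPo f) * (tnth f j)^`M(k).
Proof.
elim/mpoly_ring_ind: P => [c|i|p r IHp IHr|p r IHp IHr].
- rewrite comp_mpolyC mderivC big1 // => j _.
  by rewrite mderivC comp_mpoly0 mul0r.
- rewrite (bigD1 i) //= big1 ?addr0 => [|j /negPf ne_ji].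
    by rewrite comp_mpolyXU -tnth_nth mderiv_var eqxx comp_mpoly1 mul1r.
  by rewrite mderiv_var eq_sym ne_ji comp_mpoly0 mul0r.
- rewrite comp_mpolyD mderivD IHp IHr -big_split; apply: eq_bigr => j _ /=.
  by rewrite mderivD comp_mpolyD mulrDl.
rewrite rmorphM mderivM IHp IHr mulr_suml mulr_sumr -big_split.
apply: eq_bigr => j _ /=; rewrite mderivM comp_mpolyD !rmorphM; ring.
Qed.

End Differentials.

(** * Determinants *)

Section Cramer.
Variables (R : comNzRingType) (q : nat).
Implicit Types (A : 'M[R]_q) (b c : 'rV[R]_q).

Definition set_row A i b : 'M[R]_q :=
  \matrix_(k, j) if k == i then b 0 j else A k j.

Lemma det_set_row A i b : \det (set_row A i b) = (b *m \adj A) 0 i.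
Proof.
rewrite (expand_det_row _ i) mxE; apply: eq_bigr => j _.
rewrite !mxE eqxx /cofactor; congr (_ * (_ * \det _)).
by apply/matrixP => k l; rewrite !mxE eq_sym (negPf (neq_lift i k)).
Qed.

Lemma det_set_row_comb A i c : \det (set_row A i (c *m A)) = c 0 i * \det A.
Proof. by rewrite det_set_row -mulmxA mul_mx_adj mul_mx_scalar mxE mulrC. Qed.

End Cramer.

Lemma size_sign_mul (R : comNzRingType) (b : bool) (P : {poly R}) :
  size ((-1) ^+ b * P) = size P.
Proof. by case: b; rewrite ?expr0 ?mul1r // expr1 mulN1r size_polyN. Qed.

Lemma coef_top_det (R : comNzRingType) q (A : 'M[{poly R}]_q) (e : 'I_q -> nat) :
  (forall i j, (size (A i j) <= (e i).+1)%N) ->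
  (size (\det A) <= (\sum_i e i).+1)%N /\
  (\det A)`_(\sum_i e i) = \det (\matrix_(i, j) (A i j)`_(e i)).
Proof.
move=> sA; split.
  apply: leq_trans (size_sum _ _ _) _; apply/bigmax_leqP => s _.
  rewrite size_sign_mul.
  exact: (coef_top_prod (P := fun i => A i (s i)) (d := e) _ (fun i => sA i (s i))).1.
rewrite coef_sum; apply: eq_bigr => s _.
have := (coef_top_prod (P := fun i => A i (s i)) (d := e) (index_enum 'I_q)
  (fun i => sA i (s i))).2.
have -> (b : bool) (P : {poly R}) k : ((-1) ^+ b * P)`_k = (-1) ^+ b * P`_k.
  by case: b; rewrite ?mul1r ?mulN1r ?coefN.
by move=> ->; congr (_ * _); apply: eq_bigr => i _; rewrite mxE.
Qed.

Lemma msize_det (K : fieldType) n q (A : 'M[{mpoly K[n]}]_q) (e : 'I_q -> nat) :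
  (forall i j, (msize (A i j) <= (e i).+1)%N) ->
  (msize (\det A) <= (\sum_i e i).+1)%N.
Proof.
move=> sA; apply: leq_trans (msize_sum _ _ _) _; apply/bigmax_leqP => s _.
have -> (b : bool) (p : {mpoly K[n]}) : msize ((-1) ^+ b * p) = msize p.
  by case: b; rewrite ?expr0 ?mul1r // expr1 mulN1r msizeN.
elim/big_rec2: _ => [|i d p _ IH]; first by rewrite msize1.
have [->|A0] := eqVneq (A i (s i)) 0; first by rewrite mul0r msize0.
have [->|p0] := eqVneq p 0; first by rewrite mulr0 msize0.
move: IH (sA i (s i)); rewrite msizeM //.
by move: (msize p) (msize (A i (s i))) => x y; lia.
Qed.

(** * Polynomials whose differentials depend on given differentials *)

Section Poincare.
Variables (K : numFieldType) (n : nat).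
Implicit Types p : {mpoly K[n]}.

(** An inverse of the Euler operator: it divides the part of degree d by d, and
    drops the constant term. *)
Definition div_degree p : {mpoly K[n]} :=
  \sum_(m <- msupp p) (p@_m / (mdeg m)%:R) *: 'X_[m].

Lemma mcoeff_div_degree p m : (div_degree p)@_m = p@_m / (mdeg m)%:R.
Proof.
rewrite /div_degree raddf_sum /=.
under eq_bigr do rewrite mcoeffZ mcoeffX.
have [mp|mp] := boolP (m \in msupp p).
  rewrite (big_rem m) //= eqxx mulr1 big_seq big1 ?addr0 // => l.
  rewrite mem_rem_uniq ?msupp_uniq // inE => /andP[/negPf ne_lm _].
  by rewrite ne_lm mulr0.
rewrite big_seq big1; first by rewrite memN_msupp_eq0 // mul0r.
by move=> l lp; case: eqP lp mp => [-> ->//|_ _ _]; rewrite mulr0.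
Qed.

Lemma euler_monomial (m : 'X_{1..n}) :
  \sum_i 'X_i * 'X_[m]^`M(i) = (mdeg m)%:R *: 'X_[m] :> {mpoly K[n]}.
Proof.
rewrite mdegE natr_sum scaler_suml; apply: eq_bigr => i _.
rewrite mderivX -scalerAr; have [->|mi] := posnP (m i); first by rewrite !scale0r.
by rewrite mulrC -mpolyXD submK // lep1mP -lt0n.
Qed.

Lemma mcoeff_euler p m : (\sum_i 'X_i * p^`M(i))@_m = (mdeg m)%:R * p@_m.
Proof.
pose E (r : {mpoly K[n]}) := \sum_i 'X_i * r^`M(i).
have -> : \sum_i 'X_i * p^`M(i) = \sum_(l <- msupp p) p@_l *: E 'X_[l].
  under [RHS]eq_bigr do rewrite /E scaler_sumr.
  rewrite exchange_big; apply: eq_bigr => i _ /=.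
  rewrite {1}(mpolyE p) raddf_sum mulr_sumr; apply: eq_bigr => l _ /=.
  by rewrite mderivZ scalerAr.
rewrite [in RHS](mpolyE p) [LHS]raddf_sum [(\sum_(_ <- _) _)@_m]raddf_sum.
rewrite mulr_sumr; apply: eq_bigr => l _ /=; rewrite /E euler_monomial !mcoeffZ mcoeffX.
by case: eqP => [->|_]; [rewrite mulrCA | rewrite !mulr0].
Qed.

(** The primitive of a closed form (C_i) is sum X_i C_i with its part of degree d
    divided by d. *)
Lemma closed_exact (C : 'I_n -> {mpoly K[n]}) :
  (forall i j, (C i)^`M(j) = (C j)^`M(i)) -> exists H, forall j, H^`M(j) = C j.
Proof.
move=> closed; exists (div_degree (\sum_i 'X_i * C i)) => j; apply/mpolyP => m.
have degS : (mdeg m + 1)%:R != 0 :> K by rewrite Num.Theory.pnatr_eq0 addn1.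
rewrite mcoeff_mderiv mcoeff_div_degree mdegD mdeg1.
have eqS : (\sum_i 'X_i * C i)^`M(j)@_m = (mdeg m + 1)%:R * (C j)@_m.
  rewrite natrD mulrDl mul1r -mcoeff_euler -mcoeffD; congr (_@_m).
  rewrite raddf_sum /=.
  under eq_bigr do rewrite mderivM closed.
  rewrite big_split addrC /=; congr (_ + _).
  rewrite (bigD1 j) //= big1 ?addr0 => [|i ne_ij].
    by rewrite mderiv_var eqxx mul1r.
  by rewrite mderiv_var (negPf ne_ij) mul0r.
by rewrite -mulrnAl -mcoeff_mderiv eqS mulrC mulKf.
Qed.

End Poincare.

Lemma congruence_sym (R : idomainType) q n (J : 'M[R]_(q, n)) (N : 'M[R]_(n, q))
    (L : 'M[R]_q) :
  \det (J *m N) != 0 -> J^T *m L^T *m J = J^T *m L *m J -> L = L^T.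
Proof.
set A := J *m N => A0 eqL; apply/eqP; rewrite -subr_eq0; apply/eqP.
have : A^T *m (L - L^T) *m A = 0.
  rewrite mulmxBr mulmxBl /A trmx_mul !mulmxA.
  by rewrite -(mulmxA N^T) -(mulmxA N^T) -eqL !mulmxA subrr.
clearbody A; move/(congr1 (fun X => (\adj A)^T *m X *m \adj A)).
have adjT : (\adj A)^T *m A^T = (\det A)%:M.
  by rewrite -trmx_mul mul_mx_adj tr_scalar_mx.
rewrite mulmx0 mul0mx !mulmxA adjT -mulmxA mul_mx_adj mul_scalar_mx mul_mx_scalar scalerA => /eqP.
by rewrite scalemx_eq0 mulf_eq0 (negPf A0) /= => /eqP.
Qed.

Section Jacobian.
Variables (K : numFieldType) (n q : nat).
Implicit Types (f : q.-tuple {mpoly K[n]}) (N : 'M[K]_(n, q)) (h : {mpoly K[n]}).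

Definition grad h : 'rV[{mpoly K[n]}]_n := \row_k h^`M(k).

Definition jacobian f : 'M[{mpoly K[n]}]_(q, n) :=
  \matrix_(i, k) (tnth f i)^`M(k).

(** The minors of the Jacobian matrix, up to linear combinations: N selects or
    combines columns. Their common zeros are the points where the differentials
    of the f_i are linearly dependent. *)
Definition jminor f N : {mpoly K[n]} :=
  \det (jacobian f *m map_mx (@mpolyC n K) N).

Lemma grad_comp f (P : {mpoly K[q]}) :
  grad (P \mPo f) = (\row_j (P^`M(j) \mPo f)) *m jacobian f.
Proof.
by apply/rowP => k; rewrite !mxE mderiv_comp; apply: eq_bigr => j _; rewrite !mxE.
Qed.

Lemma jacobian_comp f (C : 'I_q -> {mpoly K[q]}) :
  jacobian [tuple C i \mPo f | i < q]
    = (\matrix_(i, j) ((C i)^`M(j) \mPo f)) *m jacobian f.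
Proof.
apply/matrixP => i k; rewrite !mxE tnth_mktuple mderiv_comp.
by apply: eq_bigr => j _; rewrite !mxE.
Qed.

End Jacobian.

(** If grad h = sum c_i grad f_i, the symmetry of the Hessian of h makes the
    matrix of the products grad c_i, grad f_i symmetric. *)
Lemma jacobian_coef_sym (K : numFieldType) n q (f c : q.-tuple {mpoly K[n]})
    (h : {mpoly K[n]}) :
  grad h = (\row_i tnth c i) *m jacobian f ->
  (jacobian c)^T *m jacobian f = (jacobian f)^T *m jacobian c.
Proof.
move=> dh; apply/matrixP => k l; apply/eqP; rewrite -subr_eq0; apply/eqP.
have dhE j : h^`M(j) = \sum_i tnth c i * (tnth f i)^`M(j).
  move/rowP/(_ j): dh; rewrite !mxE => ->.
  by apply: eq_bigr => i _; rewrite !mxE.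
have ddh j j' : h^`M(j)^`M(j') = \sum_i (tnth c i)^`M(j') * (tnth f i)^`M(j)
    + \sum_i tnth c i * (tnth f i)^`M(j)^`M(j').
  rewrite dhE raddf_sum -big_split; apply: eq_bigr => i _ /=.
  by rewrite mderivM.
have := mderiv_comm k l h; rewrite !ddh => /eqP.
under [X in _ + X == _]eq_bigr do rewrite mderiv_comm.
rewrite (inj_eq (addIr _)) !mxE => /eqP eqs; apply/eqP; rewrite subr_eq0; apply/eqP.
transitivity (\sum_i (tnth c i)^`M(k) * (tnth f i)^`M(l)).
  by apply: eq_bigr => i _; rewrite !mxE.
by rewrite -eqs; apply: eq_bigr => i _; rewrite !mxE mulrC.
Qed.

(** The key induction. Write grad h = sum c_i grad f_i with rational c_i. As no
    hypersurface consists of points where the grad f_i are dependent, Cramer's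
    rule makes the c_i polynomials; the degree of one minor being maximal,
    deg c_i < deg h. The Hessian of h shows that the grad c_i again depend on
    the grad f_i, so c_i = C_i(f) by induction, and the same symmetry shows that
    (C_i) is a closed form in the variables y_i; a primitive H of it gives
    h = H(f) up to a constant. *)
Theorem generated_by_tuple (K : numFieldType) n q (f : q.-tuple {mpoly K[n]})
    (T : 'M[K]_(n, q)) :
  alg_independent f ->
  (forall p, prime_elt p -> exists N, ~ divides p (jminor f N)) ->
  (\sum_i (tdeg (tnth f i)).-1 < msize (jminor f T))%N ->
  forall h : {mpoly K[n]},
    (exists (r : {mpoly K[n]}) (c : 'rV_q), r != 0 /\ r *: grad h = c *m jacobian f) ->
    exists P, h = P \mPo f.
Proof.
move=> indf cop degT h; have [d] := ubnP (msize h); elim: d h => // d IH h szh.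
have T0 : jminor f T != 0 by rewrite -msize_poly_eq0 -lt0n (leq_trans _ degT).
case: (EM (forall k, h^`M(k) = 0)) => [/mderiv_eq0_const -> _|].
  by exists (h@_0%MM)%:MP; rewrite comp_mpolyC.
move=> nconst; have szh1 : (1 < msize h)%N.
  rewrite ltnNge; apply/negP => /msize1_polyC hC; apply: nconst => k.
  by rewrite hC mderivC.
case=> r [c' [r0 dh]].
pose D N i := \det (set_row (jacobian f *m map_mx (@mpolyC n K) N) i
                            (grad h *m map_mx (@mpolyC n K) N)).
have cD i N : c' 0 i * jminor f N = r * D N i.
  rewrite -det_set_row_comb mulmxA -dh -scalemxAl /D !det_set_row -scalemxAl.
  by rewrite mxE.
have rdiv i : divides r (c' 0 i).
  apply: (factorial_cancel (E := jminor f) (F := D^~ i)) (cD i).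
  - exact: ufd_mpoly.
  - exact: cop.
have [c cE] := choice rdiv.
have {}dh : grad h = (\row_i c i) *m jacobian f.
  apply/rowP => k; apply: (mulfI r0).
  move/rowP/(_ k): dh; rewrite !mxE => ->; rewrite mulr_sumr.
  by apply: eq_bigr => i _; rewrite !mxE cE; ring.
have szc i : (msize (c i) < msize h)%N.
  have [->|c0] := eqVneq (c i) 0; first by rewrite msize0 ltnW.
  have : c i * jminor f T = D T i.
    by apply: (mulfI r0); rewrite -cD cE; ring.
  move/(congr1 (fun p : {mpoly K[n]} => msize p)); rewrite msizeM //.
  pose e k := if k == i then (tdeg h).-1 else (tdeg (tnth f k)).-1.
  have szD : (msize (D T i) <= (\sum_k e k).+1)%N.
    have szMC m (A : 'M[{mpoly K[n]}]_(m, n)) l k j :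
        (forall a, (msize (A k a) <= l)%N) ->
        (msize ((A *m map_mx (@mpolyC n K) T) k j) <= l)%N.
      move=> sA; rewrite mxE; apply: leq_trans (msize_sum _ _ _) _.
      apply/bigmax_leqP => a _; rewrite mxE mulrC mul_mpolyC.
      exact: leq_trans (msizeZ_le _ _) (sA a).
    have szd (p : {mpoly K[n]}) a : (msize p^`M(a) <= (tdeg p).-1.+1)%N.
      by apply: msize_mderiv; rewrite /tdeg; case: (msize p) => [|[]].
    apply: msize_det => k j; rewrite mxE /e; case: ifP => _;
      by apply: szMC => a; rewrite mxE; apply: szd.
  have : (\sum_k e k <= (tdeg h).-1 + \sum_i (tdeg (tnth f i)).-1)%N.
    rewrite (bigD1 i) //= [X in (_ <= _ + X)%N](bigD1 i) //= /e eqxx leq_add2l.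
    apply: leq_trans (leq_addl _ _); apply: leq_sum => k /negPf ne_ki.
    by rewrite ne_ki.
  move: degT szD szh1; rewrite /tdeg; move: (\sum_k e k)%N (\sum_(k < q) _)%N.
  move: (msize (c i)) (msize (jminor f T)) (msize (D T i)) (msize h).
  by lia.
pose ct := [tuple c i | i < q].
have dh' : grad h = (\row_i tnth ct i) *m jacobian f.
  by rewrite dh; congr (_ *m _); apply/rowP => i; rewrite !mxE tnth_mktuple.
have symJ := jacobian_coef_sym dh'.
set A := jacobian f *m map_mx (@mpolyC n K) T.
have cgen i : exists C : {mpoly K[q]}, c i = C \mPo f.
  apply: IH; first exact: leq_trans (szc i) _.
  pose B := jacobian ct *m map_mx (@mpolyC n K) T *m \adj A.
  exists (jminor f T), (row i B^T); split=> //.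
  have eqG : jminor f T *: (jacobian ct)^T = (jacobian f)^T *m B.
    by rewrite /B !mulmxA -symJ -(mulmxA _ (jacobian f)) -/A -mulmxA mul_mx_adj mul_mx_scalar.
  rewrite -row_mul -[B^T *m _]trmxK trmx_mul trmxK -eqG.
  by apply/rowP => k; rewrite !mxE tnth_mktuple.
have [C CE] := choice cgen.
have ctE : ct = [tuple C i \mPo f | i < q].
  by apply: eq_from_tnth => i; rewrite !tnth_mktuple.
pose L := \matrix_(i, j) ((C i)^`M(j) \mPo f).
have symL : L = L^T.
  apply: (congruence_sym T0); move: symJ.
  by rewrite ctE jacobian_comp -/L trmx_mul !mulmxA.
have closed i j : (C i)^`M(j) = (C j)^`M(i).
  apply/eqP; rewrite -subr_eq0; apply/eqP/indf; rewrite comp_mpolyB.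
  by move/matrixP/(_ i j): symL; rewrite !mxE => ->; rewrite subrr.
have [H HE] := closed_exact closed.
have {dh'} : forall k, (h - (H \mPo f))^`M(k) = 0.
  move=> k; rewrite mderivB; move/rowP/(_ k): dh.
  move/rowP/(_ k): (grad_comp f H); rewrite !mxE => -> ->.
  rewrite -sumrB big1 // => i _; rewrite !mxE HE CE subrr //.
move/mderiv_eq0_const => hE.
exists (H + ((h - (H \mPo f))@_0%MM)%:MP); rewrite comp_mpolyD comp_mpolyC -hE.
by rewrite addrC subrK.
Qed.

(** * Jacobian criterion along a prime divisor *)

Lemma msize_prod_exp (K : fieldType) n (I : Type) (r : seq I)
    (G : I -> {mpoly K[n]}) (e : I -> nat) d :
  (forall i, (msize (G i) <= d.+1)%N) ->
  (msize (\prod_(i <- r) G i ^+ e i) <= (\sum_(i <- r) d * e i).+1)%N.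
Proof.
have sM (p p' : {mpoly K[n]}) a b : (msize p <= a.+1)%N -> (msize p' <= b.+1)%N ->
    (msize (p * p')%R <= (a + b).+1)%N.
  move=> sp sp'; have [->|p0] := eqVneq p 0; first by rewrite mul0r msize0.
  have [->|p'0] := eqVneq p' 0; first by rewrite mulr0 msize0.
  by rewrite msizeM //; move: (msize p) (msize p') sp sp' => x y; lia.
move=> sG; elim: r => [|i r IH]; first by rewrite !big_nil msize1.
rewrite !big_cons; apply: (sM) => //; elim: (e i) => [|k IHk].
  by rewrite muln0 expr0 msize1.
by rewrite exprS mulnS; apply: (sM).
Qed.

(** There are more monomials of exponents < N in n.+1 variables than monomials
    of degree O(N) in n variables. *)
Lemma algebraic_relation (K : fieldType) n (G : n.+1.-tuple {mpoly K[n]}) :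
  exists2 Q : {mpoly K[n.+1]}, Q != 0 & Q \mPo G = 0.
Proof.
pose d := (\max_(l < n.+1) msize (tnth G l)).+1.
have sG l : (msize (tnth G l) <= d.+1)%N.
  by rewrite 2?leqW // (leq_bigmax (F := fun l => msize (tnth G l))).
pose D := (n.+1 * d)%N; pose N := (D ^ n).+1; pose B := (D * N)%N.
pose E := {ffun 'I_n.+1 -> 'I_N}; pose mon (e : E) := [multinom (e l : nat) | l < n.+1].
have mon_inj : injective mon.
  move=> e e' /mnmP eqe; apply/ffunP => l; apply: val_inj.
  by have := eqe l; rewrite !mnmE.
pose img e := 'X_[mon e] \mPo G.
have simg e : (msize (img e) <= B)%N.
  rewrite /img comp_mpolyX; apply: leq_trans (msize_prod_exp _ (mon e) sG) _.
  have leS : (\sum_(l < n.+1) d * mon e l <= \sum_(l < n.+1) d * N.-1)%N.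
    by apply: leq_sum => l _; rewrite leq_mul2l mnmE -ltnS ltn_ord orbT.
  apply: leq_ltn_trans leS _; rewrite sum_nat_const card_ord mulnA -/D /B.
  by rewrite ltn_mul2l ltnSn muln_gt0.
pose A := \matrix_(r < #|{: E}|, c < #|{: 'X_{1..n < B}}|)
            (img (enum_val r))@_(enum_val c).
have cardB : (#|{: 'X_{1..n < B}}| <= B ^ n)%N.
  have le_mdeg (m : 'X_{1..n}) i : (m i <= mdeg m)%N.
    by rewrite mdegE (bigD1 i) //= leq_addr.
  pose h (m : 'X_{1..n < B}) : {ffun 'I_n -> 'I_B} :=
    [ffun i => Ordinal (leq_ltn_trans (le_mdeg m i) (bmdeg m))].
  suff/leq_card : injective h by rewrite card_ffun !card_ord.
  move=> m m' /ffunP eqh; apply: val_inj; apply/mnmP => i.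
  by have := eqh i; rewrite !ffunE => /(congr1 val).
have cardE : (B ^ n < #|{: E}|)%N.
  by rewrite card_ffun !card_ord /B expnMn expnSr mulnC ltn_mul2l ltnSn expn_gt0.
have [u u0 uA] : exists2 u : 'rV_ _, u != 0 & u *m A = 0.
  have : kermx A != 0.
    rewrite kermx_eq0 /row_free neq_ltn; apply/orP; left.
    exact: leq_ltn_trans (rank_leq_col _) (leq_ltn_trans cardB cardE).
  case/rowV0Pn => u /sub_kermxP uA u0; by exists u.
exists (\sum_r u 0 r *: 'X_[mon (enum_val r)]).
  have [r ur] : exists r, u 0 r != 0 by apply/rV0Pn.
  apply: contraNneq ur => /(congr1 (mcoeff (mon (enum_val r)))).
  rewrite raddf_sum mcoeff0 (bigD1 r) //= big1 ?addr0 => [|r' ne_r].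
    by rewrite mcoeffZ mcoeffX eqxx mulr1 => ->.
  rewrite mcoeffZ mcoeffX (inj_eq mon_inj) (inj_eq enum_val_inj) (negPf ne_r).
  by rewrite mulr0.
rewrite raddf_sum; apply/mpolyP => m; rewrite mcoeff0 raddf_sum /=.
have [ltm|gem] := ltnP (mdeg m) B; last first.
  rewrite big1 // => r _; rewrite comp_mpolyZ mcoeffZ memN_msupp_eq0 ?mulr0 //.
  exact: msize_mdeg_ge (leq_trans (simg _) gem).
pose c := enum_rank (BMultinom ltm); move/rowP/(_ c): uA; rewrite !mxE.
move=> uAc; transitivity (\sum_j u 0 j * A j c) => //.
by apply: eq_bigr => r _; rewrite comp_mpolyZ mcoeffZ mxE enum_rankK.
Qed.

Section Variables.
Variables (K : numFieldType) (n : nat).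
Implicit Types p : {mpoly K[n]}.

Lemma mderiv_eq0P p k : p^`M(k) = 0 <-> forall m : 'X_{1..n}, m \in msupp p -> m k = 0%N.
Proof.
split=> [dp m mp|supp0].
  apply/eqP; apply: contraTT mp => mk; rewrite mcoeff_msupp negbK.
  move/mpolyP/(_ (m - U_(k))%MM): dp; rewrite mcoeff_mderiv mcoeff0 submK.
    by move/eqP; rewrite -mulr_natr mulf_eq0 Num.Theory.pnatr_eq0 orbF.
  by rewrite lep1mP.
rewrite (mpolyE p) raddf_sum big_seq big1 // => m mp /=.
by rewrite mderivZ mderivX supp0 // scale0r scaler0.
Qed.

Definition antideriv k p : {mpoly K[n]} :=
  \sum_(m <- msupp p) (p@_m / (m k).+1%:R) *: 'X_[m + U_(k)].

Lemma mderiv_antideriv k p : (antideriv k p)^`M(k) = p.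
Proof.
rewrite [RHS]mpolyE /antideriv raddf_sum; apply: eq_bigr => m _ /=.
rewrite mderivZ mderivX mnmDE mnm1E eqxx addn1 addmK scalerA divfK //.
by rewrite Num.Theory.pnatr_eq0.
Qed.

Lemma antideriv_indep k l p : l != k -> p^`M(l) = 0 -> (antideriv k p)^`M(l) = 0.
Proof.
move=> ne_lk /mderiv_eq0P supp0; rewrite /antideriv raddf_sum big_seq big1 // => m mp /=.
by rewrite mderivZ mderivX mnmDE mnm1E supp0 // eq_sym (negPf ne_lk) scale0r scaler0.
Qed.

Lemma msize_mderiv_lt p k : p^`M(k) != 0 -> (msize p^`M(k) < msize p)%N.
Proof.
move=> dp0; case sp: (msize p) => [|[|d]].
- by move/eqP: sp dp0; rewrite msize_poly_eq0 => /eqP ->; rewrite mderiv0 eqxx.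
- by move: dp0; rewrite (msize1_polyC (eq_leq sp)) mderivC eqxx.
by rewrite ltnS; apply: msize_mderiv; rewrite sp.
Qed.

End Variables.

Lemma divides_det_sub (R : comNzRingType) q p (A B : 'M[R]_q) :
  (forall i j, divides p (A i j - B i j)) -> divides p (\det A - \det B).
Proof.
move=> AB; rewrite -sumrB; apply: divides_sum => s _; rewrite -mulrBr.
apply: divides_mull; elim/big_rec2: _ => [|i x y _ IH].
  by rewrite subrr; apply: divides0.
have -> : A i (s i) * y - B i (s i) * x
    = (A i (s i) - B i (s i)) * y + B i (s i) * (y - x) by ring.
by apply: dividesD; [apply: divides_mulr | apply: divides_mull].
Qed.

Lemma cardC_ord n (J : {set 'I_n}) : #|~: J| = (n - #|J|)%N.
Proof. by rewrite -[X in (X - _)%N](card_ord n) -(cardsC J) addKn. Qed.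

(** Let p = P(f) generate a prime ideal (possibly 0) meeting K[f] in (P): the
    differentials of the f_j are independent at the generic point of p = 0. The
    functions f_j are completed by coordinates x_i, i in J, such that the
    relations among f and x_J modulo p are still generated by P; counting
    monomials bounds J. When J is maximal, every other coordinate is algebraic
    over f and x_J modulo p, and differentiating a minimal equation expresses its
    differential by those of f and x_J. *)
Section JacobianCriterion.
Variables (K : numFieldType) (n q : nat) (f : q.-tuple {mpoly K[n]}).
Variable P : {mpoly K[q]}.
Let p := P \mPo f.
Hypothesis prime_p : forall a b, divides p (a * b) -> divides p a \/ divides p b.
Hypothesis proper_p : ~ divides p 1.
Hypothesis p_eq0 : p = 0 -> P = 0.
Hypothesis relations_P : forall Q, divides p (Q \mPo f) -> divides P Q.

Local Notation Y := (@lshift q n).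
Local Notation Z := (@rshift q n).

Let F : (q + n).-tuple {mpoly K[n]} :=
  [tuple match split v with inl j => tnth f j | inr i => 'X_i end | v < q + n].

Let yvars : q.-tuple {mpoly K[q + n]} := [tuple 'X_(Y j) | j < q].

Let FY j : tnth F (Y j) = tnth f j.
Proof. by rewrite tnth_mktuple (unsplitK (inl j)). Qed.

Let FZ i : tnth F (Z i) = 'X_i.
Proof. by rewrite tnth_mktuple (unsplitK (inr i)). Qed.

Let comp_yvars (Q : {mpoly K[q]}) : (Q \mPo yvars) \mPo F = Q \mPo f.
Proof.
pose phi := [the {rmorphism {mpoly K[q]} -> {mpoly K[n]}} of
  comp_mpoly F \o comp_mpoly yvars].
apply: (mpoly_rmorph_eq (phi := phi) (psi := comp_mpoly f)) => [c|j] /=.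
  by rewrite !comp_mpolyC.
by rewrite !comp_mpolyXU -!tnth_nth tnth_mktuple comp_mpolyXU -tnth_nth FY.
Qed.

Let mderivX_neq (v w : 'I_(q + n)) : v != w -> ('X_v : {mpoly K[q + n]})^`M(w) = 0.
Proof. by move=> /negPf nvw; rewrite mderiv_var nvw. Qed.

Let mderiv_yvars (Q : {mpoly K[q]}) i : (Q \mPo yvars)^`M(Z i) = 0.
Proof.
rewrite mderiv_comp big1 // => j _; rewrite tnth_mktuple mderivX_neq ?mulr0 //.
by rewrite eq_lrshift.
Qed.

Let yvars_only (Q : {mpoly K[q + n]}) :
  (forall i, Q^`M(Z i) = 0) -> exists Q0, Q = Q0 \mPo yvars.
Proof.
move=> dQ; pose back : (q + n).-tuple {mpoly K[q]} :=
  [tuple if split v is inl j then 'X_j else 0 | v < q + n].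
exists (Q \mPo back); rewrite [Q \mPo back]comp_mpolyEX [LHS]mpolyE linear_sum.
apply: eq_big_seq => m mQ /=; rewrite !comp_mpolyZ; congr (_ *: _).
rewrite [LHS]mpolyXE_id comp_mpolyX rmorph_prod; apply: eq_bigr => v _ /=.
rewrite rmorphXn /= tnth_mktuple -[v]splitK; case: (split v) => [j|i].
  by rewrite !unsplitK comp_mpolyXU -tnth_nth tnth_mktuple.
by have/mderiv_eq0P -> := dQ i.
Qed.

(* no relation among f and x_J modulo p other than the multiples of P *)
Let good (J : {set 'I_n}) := forall Q : {mpoly K[q + n]},
  (forall i, i \notin J -> Q^`M(Z i) = 0) ->
  divides p (Q \mPo F) -> divides (P \mPo yvars) Q.

Let good0 : good set0.
Proof.
move=> Q dQ; have [|Q0 ->] := @yvars_only Q; first by move=> i; rewrite dQ ?inE.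
by rewrite comp_yvars => /relations_P; apply: (divides_rmorph (comp_mpoly yvars)).
Qed.

Let good_free J : good J -> forall Q : {mpoly K[q + n]},
  (forall i, i \notin J -> Q^`M(Z i) = 0) -> Q \mPo F = 0 -> Q = 0.
Proof.
move=> gJ Q; have [d] := ubnP (msize Q); elim: d Q => // d IH Q szQ dQ Q0.
have: divides (P \mPo yvars) Q by apply: gJ => //; rewrite Q0; apply: divides0.
case=> S def_Q; have [P0|Pn0] := eqVneq P 0.
  by rewrite def_Q P0 comp_mpoly0 mulr0.
have pn0 : p != 0 by apply: contraNneq Pn0 => /p_eq0 ->.
have Pwn0 : P \mPo yvars != 0.
  by apply: contraNneq pn0 => Pw0; rewrite /p -comp_yvars Pw0 comp_mpoly0.
have [->|Qn0] := eqVneq Q 0 => //.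
have Sn0 : S != 0 by apply: contraNneq Qn0 => S0; rewrite def_Q S0 mul0r.
suff S0 : S = 0 by rewrite S0 eqxx in Sn0.
apply: IH.
- suff szP : (1 < msize (P \mPo yvars))%N.
    move: szQ; rewrite def_Q msizeM //; move: Sn0; rewrite -msize_poly_eq0.
    by move: (msize S) (msize _) szP => x y; lia.
  rewrite ltnNge; apply/negP => /msize1_polyC Pc; apply: proper_p.
  have pc : p = ((P \mPo yvars)@_0%MM)%:MP.
    by rewrite /p -comp_yvars {1}Pc comp_mpolyC.
  have cn0 : (P \mPo yvars)@_0%MM != 0.
    by apply: contraNneq pn0 => c0; rewrite pc c0.
  by exists (((P \mPo yvars)@_0%MM)^-1)%:MP; rewrite pc -rmorphM mulVf.
- move=> i iJ; apply: (mulIf Pwn0).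
  by have := dQ i iJ; rewrite def_Q mderivM mderiv_yvars mulr0 addr0 mul0r.
- by apply: (mulIf pn0); rewrite mul0r /p -comp_yvars -rmorphM -def_Q.
Qed.

Let good_card J : good J -> (q + #|J| <= n)%N.
Proof.
move=> gJ; rewrite leqNgt; apply/negP => ltn.
pose A := ~: [set Z i | i in ~: J].
have cardA : (n.+1 <= #|A|)%N.
  apply: leq_trans ltn _; rewrite (cardsCs A) setCK card_imset; last exact: rshift_inj.
  rewrite card_ord cardC_ord; have : (#|J| <= n)%N.
    by rewrite -[X in (_ <= X)%N](card_ord n) max_card.
  by move: #|J| ltn => k; lia.
pose iota l : 'I_(q + n) := enum_val (widen_ord cardA l).
have iotaI : injective iota.
  by move=> l l' /enum_val_inj/(congr1 val) /= /val_inj.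
have iotaZ l i : i \notin J -> iota l != Z i.
  move=> iJ; apply: contraTneq (enum_valP (widen_ord cardA l)).
  by rewrite -/(iota l) => ->; rewrite !inE negbK imset_f // inE.
have [Q Q0 QF] := algebraic_relation [tuple tnth F (iota l) | l < n.+1].
pose names := [tuple 'X_(iota l) : {mpoly K[q + n]} | l < n.+1].
case/negP: Q0; apply/eqP.
have back : Q \mPo names = 0.
  apply: (good_free gJ) => [i iJ|].
    rewrite mderiv_comp big1 // => l _.
    by rewrite tnth_mktuple mderivX_neq ?mulr0 ?iotaZ.
  rewrite -[RHS]QF.
  pose phi := [the {rmorphism {mpoly K[n.+1]} -> {mpoly K[n]}} of
    comp_mpoly F \o comp_mpoly names].
  apply: (mpoly_rmorph_eq (phi := phi) (psi := comp_mpoly _)) => [c|j] /=.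
    by rewrite !comp_mpolyC.
  rewrite !comp_mpolyXU -!tnth_nth [tnth names j]tnth_mktuple comp_mpolyXU.
  by rewrite -tnth_nth [RHS]tnth_mktuple.
pose unname := [tuple if [pick l | iota l == v] is Some l
                      then 'X_l : {mpoly K[n.+1]} else 0 | v < q + n].
suff unK : (Q \mPo names) \mPo unname = Q by rewrite -unK back comp_mpoly0.
pose phi := [the {rmorphism {mpoly K[n.+1]} -> {mpoly K[n.+1]}} of
  comp_mpoly unname \o comp_mpoly names].
apply: (mpoly_rmorph_eq (phi := phi) (psi := idfun)) => [c|l] /=.
  by rewrite !comp_mpolyC.
rewrite !comp_mpolyXU -!tnth_nth !tnth_mktuple comp_mpolyXU -tnth_nth tnth_mktuple.
by case: pickP => [l' /eqP/iotaI -> //|/(_ l)]; rewrite eqxx.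
Qed.

Let good_step J i : good J -> i \notin J -> ~ good (i |: J) ->
  exists (delta : {mpoly K[n]}) (C : 'I_q -> {mpoly K[n]}), ~ divides p delta /\
    forall k, k \notin J ->
      divides p ((k == i)%:R * delta - \sum_j C j * (tnth f j)^`M(k)).
Proof.
move=> gJ iJ ngJ.
pose bad Q := [/\ forall k, k \notin i |: J -> Q^`M(Z k) = 0,
  divides p (Q \mPo F) & ~ divides (P \mPo yvars) Q].
have [Q [dQ pQ nPQ] minQ] : exists2 Q, bad Q &
    forall Q', bad Q' -> (msize Q <= msize Q')%N.
  have exQ : exists d, `[< exists2 Q, bad Q & msize Q = d >].
    apply: contrapT => nex; apply: ngJ => Q dQ pQ; apply: contrapT => nPQ.
    by apply: nex; exists (msize Q); apply/asboolP; exists Q.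
  case: (ex_minnP exQ) => d /asboolP [Q bQ szQ] mind; exists Q => // Q' bQ'.
  by rewrite szQ; apply: mind; apply/asboolP; exists Q'.
have dZ k : k \notin J -> k != i -> Q^`M(Z k) = 0.
  by move=> kJ ki; apply: dQ; rewrite !inE negb_or ki.
exists (Q^`M(Z i) \mPo F); case: (pQ) => s def_s.
exists (fun j => s * (P^`M(j) \mPo f) - (Q^`M(Y j) \mPo F)); split.
  (* otherwise P divides the derivative of the minimal Q, and integrating the
     quotient in z_i removes z_i from Q without changing it modulo P *)
  move=> pdQ; apply: nPQ.
  have [S def_S] : divides (P \mPo yvars) Q^`M(Z i).
    apply: contrapT => nPdQ; have bdQ : bad Q^`M(Z i).
      by split=> // k kJ; rewrite mderiv_comm dQ // mderiv0.
    have := minQ _ bdQ; rewrite leqNgt msize_mderiv_lt //.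
    by apply/eqP => dQ0; apply: nPdQ; rewrite dQ0; apply: divides0.
  pose I := antideriv (Z i) S.
  rewrite -[Q](subrK (I * (P \mPo yvars))).
  apply: dividesD; last by apply: divides_mull; apply: dividesxx.
  apply: gJ => [k kJ|]; last first.
    rewrite rmorphB rmorphM /= comp_yvars; apply: dividesB => //.
    by apply: divides_mull; apply: dividesxx.
  rewrite mderivB mderivM mderiv_yvars mulr0 addr0.
  have [->|ki] := eqVneq k i; first by rewrite mderiv_antideriv def_S subrr.
  rewrite dZ // sub0r.
  have [->|Pn0] := eqVneq (P \mPo yvars) 0; first by rewrite mulr0 oppr0.
  rewrite antideriv_indep ?mul0r ?oppr0 ?(inj_eq (@rshift_inj _ _)) //.
  apply: (mulIf Pn0); rewrite mul0r.
  have := mderiv_comm (Z i) (Z k) Q; rewrite (dZ k) // mderiv0 def_S mderivM.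
  by rewrite mderiv_yvars mulr0 addr0.
move=> k kJ; have dk : (Q \mPo F)^`M(k) =
    \sum_j (Q^`M(Y j) \mPo F) * (tnth f j)^`M(k) + (k == i)%:R * (Q^`M(Z i) \mPo F).
  rewrite mderiv_comp big_split_ord /=; congr (_ + _).
    by apply: eq_bigr => j _; rewrite FY.
  rewrite (bigD1 k) //= big1 ?addr0 => [|l lk]; last first.
    by rewrite FZ mderiv_var (negPf lk) mulr0.
  rewrite FZ mderiv_var eqxx mulr1.
  have [->|ki] := eqVneq k i; first by rewrite mul1r.
  by rewrite dZ // comp_mpoly0 mul0r.
exists s^`M(k); move: dk; rewrite def_s mderivM {2}/p mderiv_comp => dk.
under eq_bigr do rewrite mulrBl -mulrA.
by rewrite sumrB -mulr_sumr opprB addrA [X in X - _]addrC -dk addrK.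
Qed.

Lemma jacobian_criterion : exists N, ~ divides p (jminor f N).
Proof.
have [J gJ maxJ] : exists2 J, good J & forall i, i \notin J -> ~ good (i |: J).
  suff ext d (J : {set 'I_n}) : (n - #|J| <= d)%N -> good J ->
      exists2 J, good J & forall i, i \notin J -> ~ good (i |: J).
    exact: (ext n set0 (leq_subr _ _) good0).
  elim: d J => [|d IH] J szJ gJ.
    exists J => // i iJ _; have : (0 < #|~: J|)%N.
      by apply/card_gt0P; exists i; rewrite inE.
    by rewrite cardC_ord; move: szJ; rewrite leqn0 => /eqP ->.
  case: (EM (exists2 i, i \notin J & good (i |: J))) => [[i iJ giJ]|nex].
    by apply: IH giJ; rewrite cardsU1 iJ; move: #|J| szJ => k; lia.
  by exists J => // i iJ giJ; apply: nex; exists i.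
have leqJ : (q <= #|~: J|)%N.
  by rewrite cardC_ord; have := good_card gJ; move: #|J| => k; lia.
pose io j : 'I_n := enum_val (widen_ord leqJ j).
have ioI : injective io by move=> l l' /enum_val_inj/(congr1 val) /= /val_inj.
have ioJ j : io j \notin J.
  by have := enum_valP (widen_ord leqJ j); rewrite inE.
have step a := good_step gJ (ioJ a) (maxJ _ (ioJ a)).
have [delta {}step] := choice step; have [C {}step] := choice step.
pose N := \matrix_(k < n, j < q) ((k == io j)%:R : K).
exists N => pN.
have JN l j : (jacobian f *m map_mx (@mpolyC n K) N) l j = (tnth f l)^`M(io j).
  rewrite mxE (bigD1 (io j)) //= big1 ?addr0 => [|k nk].
    by rewrite !mxE eqxx mpolyC1 mulr1.
  by rewrite !mxE (negPf nk) mpolyC0 mulr0.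
have : divides p (\det (diag_mx (\row_a delta a))).
  rewrite -[\det _](subrK (\det ((\matrix_(a, l) C a l) *m
                                 (jacobian f *m map_mx (@mpolyC n K) N)))).
  apply: dividesD; last by rewrite det_mulmx; apply: divides_mull.
  apply: divides_det_sub => a j; have [_ /(_ _ (ioJ j))] := step a.
  rewrite (inj_eq ioI) !mxE mulr_natl eq_sym.
  under eq_bigr do rewrite -JN.
  congr (divides p (_ - _)); apply: eq_bigr => l _; by rewrite [in RHS]mxE.
rewrite det_diag; elim/big_rec: _ => [/proper_p //|a x _ IH].
by case/prime_p => //; rewrite mxE; case: (step a).
Qed.

End JacobianCriterion.

(** * Kernels of pencils in Jordan-Kronecker form *)

Section BlockKernels.
Variable K : fieldType.
Implicit Types b : jk_block K.

Local Notation rows := (Defs.total (@jk_rows K)).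
Local Notation cols := (Defs.total (@jk_cols K)).

Definition jk_pencil_block b : 'M[{poly K}]_(jk_rows b, jk_cols b) :=
  map_mx polyC (jk_A b) + 'X *: map_mx polyC (jk_B b).

Definition jk_pencil bs :
    'M[{poly K}]_(rows bs, cols bs) :=
  map_mx polyC (block_diag (@jk_A K) bs)
    + 'X *: map_mx polyC (block_diag (@jk_B K) bs).

Lemma jk_pencil_cons b bs :
  jk_pencil (b :: bs) = block_mx (jk_pencil_block b) 0 0 (jk_pencil bs).
Proof.
by rewrite /jk_pencil /= !map_block_mx scale_block_mx add_block_mx !map_mx0
  !scaler0 !addr0.
Qed.

(** Indices in nat, where predecessors make sense; 0 outside the range. *)
Definition entry m (phi : 'rV[{poly K}]_m) (i : nat) : {poly K} :=
  if insub i is Some i' then phi 0 i' else 0.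

Lemma entryE m (phi : 'rV[{poly K}]_m) (i : 'I_m) : entry phi i = phi 0 i.
Proof. by rewrite /entry valK. Qed.

Lemma sum_entry m (phi : 'rV[{poly K}]_m) i :
  \sum_(k < m) phi 0 k * (k == i :> nat)%:R = entry phi i.
Proof.
rewrite /entry; case: insubP => [i' _ <-|nlt].
  rewrite (bigD1 i') //= big1 ?addr0 ?eqxx ?mulr1 // => k.
  by rewrite -val_eqE /= => /negPf ->; rewrite mulr0.
rewrite big1 // => k _; case: eqP => [ek|_]; last by rewrite mulr0.
by rewrite -ek ltn_ord in nlt.
Qed.

Lemma sum_entry_succ m (phi : 'rV[{poly K}]_m) i :
  \sum_(k < m) phi 0 k * (i == k.+1 :> nat)%:R
    = if i is i'.+1 then entry phi i' else 0.
Proof.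
case: i => [|i]; first by rewrite big1 // => k _; rewrite mulr0.
by rewrite -sum_entry; apply: eq_bigr => k _; rewrite eqSS eq_sym.
Qed.

(** Only vertical blocks have a nonzero left kernel over K[X]; it consists of the
    multiples of (1, X, ..., X^k). *)
Lemma jk_block_kernel b (phi : 'rV[{poly K}]_(jk_rows b)) :
  phi *m jk_pencil_block b = 0 ->
  if b is VerticalBlock k then forall i, (i <= k)%N -> entry phi i = entry phi 0 * 'X^i
  else phi = 0.
Proof.
move=> ker0.
have all0 : (forall i, (i < jk_rows b)%N ->
    (forall k, (k < i)%N -> entry phi k = 0) -> entry phi i = 0) -> phi = 0.
  move=> step; apply/rowP => i; rewrite mxE -entryE.
  have [m] := ubnP i; move: (i : nat) (ltn_ord i) => {}i; elim: m i => // m IH i ib im.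
  apply: step => // k ki; apply: IH; first exact: ltn_trans ki ib.
  exact: leq_trans ki im.
have col j : \sum_i phi 0 i * ((jk_A b i j)%:P + 'X * (jk_B b i j)%:P) = 0.
  move/rowP/(_ j): ker0; rewrite !mxE => ker0; rewrite -[RHS]ker0.
  by apply: eq_bigr => i _; rewrite !mxE.
case: b phi ker0 all0 col => [k l|k|k|k] phi _ all0 col.
- apply: all0 => i ik IH; have := col (Ordinal ik); rewrite /=.
  under eq_bigr do rewrite !mxE /= polyCD polyCMn polyCN !rmorph_nat.
  move=> eq0; have {eq0}: entry phi i * (l%:P - 'X) +
      (if i is i'.+1 then entry phi i' else 0) = 0.
    rewrite -[RHS]eq0 -sum_entry -sum_entry_succ mulr_suml -big_split.
    by apply: eq_bigr => r _ /=; rewrite -mulr_natr; ring.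
  have -> : (if i is i'.+1 then entry phi i' else 0) = 0 by case: i IH {ik} => // i ->.
  rewrite addr0 => /eqP; rewrite mulf_eq0 -opprB oppr_eq0 polyXsubC_eq0 orbF.
  by move/eqP.
- apply: all0 => i ik IH; have := col (Ordinal ik); rewrite /=.
  under eq_bigr do rewrite !mxE /= polyCN !rmorph_nat.
  move=> eq0; have {eq0}: entry phi i -
      'X * (if i is i'.+1 then entry phi i' else 0) = 0.
    rewrite -[RHS]eq0 -sum_entry -sum_entry_succ mulr_sumr -sumrB.
    by apply: eq_bigr => r _ /=; ring.
  have -> : (if i is i'.+1 then entry phi i' else 0) = 0 by case: i IH {ik} => // i ->.
  by rewrite mulr0 subr0.
- apply: all0 => i ik IH; have := col (Ordinal (leqW ik)); rewrite /=.
  under eq_bigr do rewrite !mxE /= polyCN !rmorph_nat.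
  move=> eq0; have {eq0}: (if i is i'.+1 then entry phi i' else 0) -
      'X * entry phi i = 0.
    rewrite -[RHS]eq0 -sum_entry -sum_entry_succ mulr_sumr -sumrB.
    by apply: eq_bigr => r _ /=; ring.
  have -> : (if i is i'.+1 then entry phi i' else 0) = 0 by case: i IH {ik} => // i ->.
  move/eqP; rewrite sub0r oppr_eq0 mulf_eq0 polyX_eq0 /=.
  by move/eqP.
elim=> [|i IH] ik; first by rewrite mulr1.
have := col (Ordinal ik); rewrite /=.
under eq_bigr do rewrite !mxE /= polyCN !rmorph_nat.
move=> eq0; have {eq0}: entry phi i.+1 - 'X * entry phi i = 0.
  rewrite -[RHS]eq0 -!sum_entry mulr_sumr -sumrB.
  by apply: eq_bigr => r _ /=; ring.
move/eqP; rewrite subr_eq0 => /eqP ->; rewrite IH 1?ltnW // exprS; ring.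
Qed.

(** The shape of the left kernel over K[X] of a pencil with vertical indices vs:
    its elements are combinations of the rows of Phi, whose degrees are at most
    vs_j - 1. The constant matrix S reads off the coefficients of the combination,
    and T the same coefficients multiplied by X^(vs_j - 1). *)
Definition kernel_frame m (ker : 'rV[{poly K}]_m -> Prop) (vs : seq nat) : Prop :=
  exists (S T : 'M[K]_(m, size vs)) (Phi : 'M[{poly K}]_(size vs, m)),
    (forall j i, (size (Phi j i) <= nth 0%N vs j)%N) /\
    forall phi : 'rV_m, ker phi ->
      phi = (phi *m map_mx polyC S) *m Phi /\
      forall j, (phi *m map_mx polyC T) 0 j
                  = (phi *m map_mx polyC S) 0 j * 'X^((nth 0%N vs j).-1).

Section BlockSum.
Variables (m2 c2 : nat) (N2 : 'M[{poly K}]_(m2, c2)).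
Variable vs : seq nat.
Hypothesis frame2 : kernel_frame (fun phi => phi *m N2 = 0) vs.

Lemma kernel_block m1 c1 (N1 : 'M[{poly K}]_(m1, c1)) (phi : 'rV[{poly K}]_(m1 + m2)) :
  phi *m block_mx N1 0 0 N2 = 0 -> lsubmx phi *m N1 = 0 /\ rsubmx phi *m N2 = 0.
Proof.
rewrite -{1}[phi]hsubmxK mul_row_block !mulmx0 addr0 add0r => /eqP.
by rewrite row_mx_eq0 => /andP[/eqP -> /eqP ->].
Qed.

Lemma kernel_frame_zero m1 c1 (N1 : 'M[{poly K}]_(m1, c1)) :
  (forall phi : 'rV_m1, phi *m N1 = 0 -> phi = 0) ->
  kernel_frame (fun phi => phi *m block_mx N1 0 0 N2 = 0) vs.
Proof.
move=> ker1; have [S [T [Phi [szPhi frame]]]] := frame2.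
exists (col_mx 0 S), (col_mx 0 T), (row_mx 0 Phi); split=> [j i|phi kphi].
  by rewrite mxE; case: split => i'; rewrite ?szPhi // mxE size_poly0.
have [/ker1 phi1 /frame [phi2 phiT]] := kernel_block kphi.
rewrite -[phi]hsubmxK phi1 !map_col_mx !mul_row_col !mul0mx !add0r.
by split=> //; rewrite mul_mx_row mulmx0 -phi2.
Qed.

Lemma kernel_frame_vertical k c1 (N1 : 'M[{poly K}]_(k.+1, c1)) :
  (forall phi : 'rV_k.+1, phi *m N1 = 0 ->
     forall i, (i <= k)%N -> entry phi i = entry phi 0 * 'X^i) ->
  kernel_frame (fun phi => phi *m block_mx N1 0 0 N2 = 0) (k.+1 :: vs).
Proof.
move=> ker1; have [S [T [Phi [szPhi frame]]]] := frame2.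
pose Psi : 'rV[{poly K}]_k.+1 := \row_i 'X^i.
pose S' := block_mx (delta_mx ord0 (0 : 'I_1)) 0 0 S : 'M_(k.+1 + m2, 1 + size vs).
pose T' := block_mx (delta_mx ord_max (0 : 'I_1)) 0 0 T : 'M_(k.+1 + m2, 1 + size vs).
pose Phi' := block_mx Psi 0 0 Phi : 'M_(1 + size vs, k.+1 + m2).
have szPhi' j r : (size (Phi' j r) <= nth 0%N (k.+1 :: vs) j)%N.
  rewrite -[j]splitK -[r]splitK /Phi'.
  case: (split j) => j'; case: (split r) => r' /=.
  - by rewrite block_mxEul mxE size_polyXn ord1 /= ltn_ord.
  - by rewrite block_mxEur mxE size_poly0.
  - by rewrite block_mxEdl mxE size_poly0.
  - by rewrite block_mxEdr.
exists S', T', Phi'; split=> // phi kphi.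
have [/ker1 phi1 /frame [phi2 phiT]] := kernel_block kphi.
have deltaE (l : 'I_k.+1) : lsubmx phi *m map_mx polyC (delta_mx l (0 : 'I_1))
    = (entry (lsubmx phi) l)%:M.
  apply/rowP => j; rewrite ord1 !mxE (bigD1 l) //= big1 ?addr0 => [|l' /negPf nl].
    by rewrite !mxE !eqxx mulr1 entryE mxE.
  by rewrite !mxE nl mulr0.
have phiS' : phi *m map_mx polyC S'
    = row_mx (entry (lsubmx phi) 0)%:M (rsubmx phi *m map_mx polyC S).
  rewrite -{1}[phi]hsubmxK map_block_mx !map_mx0 mul_row_block !mulmx0 addr0 add0r.
  by rewrite (deltaE ord0).
have phiT' : phi *m map_mx polyC T'
    = row_mx (entry (lsubmx phi) k)%:M (rsubmx phi *m map_mx polyC T).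
  rewrite -{1}[phi]hsubmxK map_block_mx !map_mx0 mul_row_block !mulmx0 addr0 add0r.
  by rewrite (deltaE ord_max).
have phiE : phi = phi *m map_mx polyC S' *m Phi'.
  rewrite phiS' /Phi' mul_row_block !mulmx0 addr0 add0r -phi2 -{1}[phi]hsubmxK.
  congr row_mx; apply/rowP => l; rewrite mul_scalar_mx !mxE -(phi1 l) ?entryE ?mxE //.
  by rewrite -ltnS.
have powT (j : 'I_(1 + size vs)) : (phi *m map_mx polyC T') 0 j
    = (phi *m map_mx polyC S') 0 j * 'X^((nth 0%N (k.+1 :: vs) j).-1).
  rewrite phiS' phiT' -[j]splitK; case: (split j) => j' /=.
    by rewrite !row_mxEl ord1 !mxE !eqxx !mulr1n (phi1 k).
  by rewrite !row_mxEr phiT.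
by split; [exact: phiE | exact: powT].
Qed.

End BlockSum.

Lemma jk_kernel (bs : seq (jk_block K)) :
  kernel_frame (fun phi => phi *m jk_pencil bs = 0)
    (vertical_heights [seq jk_type b | b <- bs]).
Proof.
elim: bs => [|b bs IH].
  by exists 0, 0, 0; split=> [[]//|phi _]; split=> [|[]//]; apply/rowP => -[].
rewrite jk_pencil_cons; have := @jk_block_kernel b.
case: b => [k l|k|k|k] kerb.
- exact: kernel_frame_zero.
- exact: kernel_frame_zero.
- exact: kernel_frame_zero.
- exact: (kernel_frame_vertical IH).
Qed.

End BlockKernels.

(** The row phi stands for a linear form on V, in the coordinates attached to
    vbasis, with coefficients in K[X]. *)
Definition kills_pencil (K : fieldType) (g V : vectType K) (A B : 'Hom(g, V))
    (phi : 'rV[{poly K}]_(\dim {:V})) : Prop :=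
  forall xi, \sum_k phi 0 k * ((vcoord (A xi) k)%:P + 'X * (vcoord (B xi) k)%:P) = 0.

Lemma vcoordP (K : fieldType) (V : vectType K) (x : V) :
  x = \sum_i vcoord x i *: (vbasis {:V})`_i.
Proof. exact: coord_vbasis (memvf x). Qed.

Lemma jk_form_kernel (K : fieldType) (g V : vectType K) (A B : 'Hom(g, V)) bs :
  jk_form A B bs ->
  kernel_frame (kills_pencil A B) (vertical_heights [seq jk_type b | b <- bs]).
Proof.
case=> u [w [bu bw matA matB]].
have [S [T [Phi [szPhi frame]]]] := jk_kernel bs.
(* W and W' express the two bases of V in one another *)
pose n := \dim {:V}; pose m := Defs.total (@jk_rows K) bs.
pose W := \matrix_(k < n, i < m) vcoord w`_i k.
pose W' := \matrix_(i < m, k < n) coord w i (vbasis {:V})`_k.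
have wE x : x = \sum_i coord w i x *: w`_i by apply: coord_basis (memvf x).
have vcoord_sum x k : vcoord x k = \sum_i coord w i x * vcoord w`_i k.
  by rewrite {1}/vcoord {1}(wE x) linear_sum; apply: eq_bigr => i _; rewrite linearZ.
have WW' : W *m W' = 1%:M.
  apply/matrixP => k l; rewrite !mxE.
  have := vcoord_sum (vbasis {:V})`_l k; rewrite /vcoord coord_free; last first.
    exact: basis_free (vbasisP _).
  rewrite eq_sym => ->; apply: eq_bigr => i _; by rewrite !mxE mulrC.
exists (W *m S), (W *m T), (Phi *m map_mx polyC W'); split=> [j k|phi kphi].
  rewrite mxE; apply: leq_trans (size_sum _ _ _) _; apply/bigmax_leqP => i _.
  rewrite mxE mulrC mul_polyC; exact: leq_trans (size_scale_leq _ _) (szPhi j i).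
have /frame [phiE phiT] : phi *m map_mx polyC W *m jk_pencil bs = 0.
  apply/rowP => j; rewrite -mulmxA !mxE -[RHS](kphi (tnth u j)).
  apply: eq_bigr => k _; congr (_ * _); rewrite mxE !vcoord_sum !rmorph_sum mulr_sumr.
  rewrite -big_split; apply: eq_bigr => i _ /=.
  by rewrite !mxE -matA -matB !mxE !rmorphM; ring.
rewrite !map_mxM !mulmxA; split=> //.
rewrite -phiE -mulmxA -map_mxM WW' map_mx1 mulmx1 //.
Qed.

(** * Common zeros of polynomials without common factor *)

(** A common factor of A and B over the fraction field would, up to constants,
    be the prime A itself. *)
Lemma prime_bezout (R : idomainType) (A B : {poly R}) :
  prime_elt A -> ~ divides A B ->
  exists r u v, r != 0 /\ u * A + v * B = r%:P.
Proof.
move=> [A0 A1 AM] nAB; pose d := Pdiv.Idomain.gcdp A B.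
have d0 : d != 0 by rewrite /d Pdiv.Idomain.gcdp_eq0 negb_and A0.
have [szd|szd] := eqVneq (size d) 1.
  have [[u v] /=] := Pdiv.Idomain.Bezoutp A B; rewrite -/d.
  case/Pdiv.Idomain.eqpP => -[c1 c2] /= /andP[c10 c20] bez.
  have dC : d = (d`_0)%:P by apply: size1_polyC; rewrite szd.
  exists (c2 * d`_0), (c1%:P * u), (c1%:P * v); split.
    by rewrite mulf_neq0 // -polyC_eq0 -dC.
  by rewrite polyCM -dC !mul_polyC -bez scalerDr !scalerAl.
have szA : (1 < size A)%N.
  apply: leq_trans (Pdiv.Idomain.leq_gcdpl B A0); rewrite -/d.
  by move: szd d0; rewrite -size_poly_gt0; case: (size d) => [|[]].
have constM c g : c != 0 -> divides A (c%:P * g) -> divides A g.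
  move=> c0 /AM[] // [s /(congr1 (fun P : {poly R} => size P))].
  have [->|s0] := eqVneq s 0; first by rewrite mul0r size_polyC c0 size_poly0.
  rewrite size_polyC c0 size_mul //; move: s0; rewrite -size_poly_gt0; lia.
have dA : Pdiv.Idomain.dvdp d A by apply: Pdiv.Idomain.dvdp_gcdl.
have dB : Pdiv.Idomain.dvdp d B by apply: Pdiv.Idomain.dvdp_gcdr.
case/Pdiv.Idomain.dvdpP: dA => -[c k] /= c0 eqA.
have k0 : k != 0.
  apply: contraNneq A0 => k0; move/eqP: eqA.
  by rewrite k0 mul0r -mul_polyC mulf_eq0 polyC_eq0 (negPf c0).
have: divides A (k * d) by rewrite -eqA -mul_polyC; apply: divides_mull; apply: dividesxx.
case/AM => [[s def_k]|Ad].
  have: size (c *: A) = size (k * d) by rewrite eqA.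
  have s0 : s != 0 by apply: contraNneq k0 => s0; rewrite def_k s0 mul0r.
  rewrite size_scale // size_mul // def_k size_mul //.
  move: s0 szd d0 szA; rewrite -!size_poly_gt0 => + /eqP; lia.
case/Pdiv.Idomain.dvdpP: dB => -[c' k'] /= c'0 eqB; case: nAB.
by apply: (constM c') => //; rewrite mul_polyC eqB; apply: divides_mull.
Qed.

Section GenericLines.
Variables (K : fieldType) (n : nat).
Implicit Types (b : 'I_n -> K) (p h : {mpoly K[n]}).

(** The restriction of p to the line through a generic point with direction b. *)
Definition generic_line b : {mpoly K[n]} -> {poly {mpoly K[n]}} :=
  mmap (polyC \o @mpolyC n K) (fun i => ('X_i)%:P + (b i)%:MP%:P * 'X).

HB.instance Definition _ b := GRing.RMorphism.on (generic_line b).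

(** Its extension to an automorphism of K[x][t] fixing t: it carries the prime p
    of K[x][t] to the restriction of p, which is therefore prime. *)
Definition translation b : {poly {mpoly K[n]}} -> {poly {mpoly K[n]}} :=
  horner_eval 'X \o map_poly (generic_line b).

HB.instance Definition _ b := GRing.RMorphism.on (translation b).

Lemma translationC b p : translation b p%:P = generic_line b p.
Proof. by rewrite /translation /= map_polyC /horner_eval hornerC. Qed.

Lemma translationX b : translation b 'X = 'X.
Proof. by rewrite /translation /= map_polyX /horner_eval hornerX. Qed.

Lemma generic_lineC b c : generic_line b c%:MP = c%:MP%:P.
Proof. by rewrite /generic_line mmapC. Qed.

Lemma generic_lineX b i : generic_line b 'X_i = ('X_i)%:P + (b i)%:MP%:P * 'X.
Proof. by rewrite /generic_line mmapX mmap1U. Qed.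

Lemma translationK b b' : (forall i, b' i = - b i) ->
  cancel (translation b) (translation b').
Proof.
move=> b'E P; pose phi := [the {rmorphism {poly {mpoly K[n]}} -> {poly {mpoly K[n]}}}
  of translation b' \o translation b].
apply: (poly_rmorph_eq (phi := phi) (psi := idfun)) => [p|] /=; last first.
  by rewrite !translationX.
pose chi := [the {rmorphism {mpoly K[n]} -> {poly {mpoly K[n]}}}
  of translation b' \o (translation b \o polyC)].
apply: (mpoly_rmorph_eq (phi := chi) (psi := polyC)) => [c|i] /=.
  by rewrite translationC generic_lineC translationC generic_lineC.
rewrite translationC generic_lineX rmorphD rmorphM /= !translationC translationX.
by rewrite generic_lineX generic_lineC b'E !rmorphN mulNr subrK.
Qed.

Lemma prime_generic_line b p : prime_elt p -> prime_elt (generic_line b p).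
Proof.
move=> pp; rewrite -translationC.
apply: (@prime_iso _ _ (translation b) (translation (fun i => - b i))).
- exact: translationK.
- by apply: translationK => i; rewrite opprK.
- exact: prime_polyC.
Qed.

Lemma generic_line0 b p : (generic_line b p).[0] = p.
Proof.
pose phi := [the {rmorphism {mpoly K[n]} -> {mpoly K[n]}} of
  horner_eval 0 \o generic_line b].
apply: (mpoly_rmorph_eq (phi := phi) (psi := idfun)) => [c|i] /=.
  by rewrite generic_lineC /horner_eval hornerC.
by rewrite generic_lineX /horner_eval !hornerE.
Qed.

Lemma generic_line_eval a b t :
  exists phi : {rmorphism {poly {mpoly K[n]}} -> K},
    (forall r, phi r%:P = r.@[a]) /\
    (forall p, phi (generic_line b p) = p.@[fun i => a i + t * b i]).
Proof.
exists [the {rmorphism {poly {mpoly K[n]}} -> K} of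
  horner_eval t \o map_poly (meval a)]; split=> [r|p] /=.
  by rewrite map_polyC /horner_eval hornerC.
pose phi := [the {rmorphism {mpoly K[n]} -> K} of
  horner_eval t \o map_poly (meval a) \o generic_line b].
apply: (mpoly_rmorph_eq (phi := phi) (psi := meval _)) => [c|i] /=.
  by rewrite generic_lineC map_polyC /horner_eval hornerC /= !mevalC.
rewrite generic_lineX rmorphD rmorphM /= !map_polyC map_polyX /horner_eval !hornerE /=.
by rewrite !mevalXU mevalC mulrC.
Qed.

Lemma prime_coprime_line b p h : prime_elt p -> ~ divides p h ->
  exists2 r : {mpoly K[n]}, r != 0 &
    forall a t, p.@[fun i => a i + t * b i] = 0 ->
      h.@[fun i => a i + t * b i] = 0 -> r.@[a] = 0.
Proof.
move=> pp nph; have [||r [u [v [r0 bez]]]] :=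
    @prime_bezout _ (generic_line b p) (generic_line b h).
- exact: prime_generic_line.
- move=> pdh; apply: nph; rewrite -(generic_line0 b h) -(generic_line0 b p).
  exact: (divides_rmorph (horner_eval 0)).
exists r => // a t pz hz; have [phi [phiC phiL]] := generic_line_eval a b t.
move: (phiL p) (phiL h) bez; rewrite pz hz.
move: (generic_line b p) (generic_line b h) => x y phix phiy bez.
by rewrite -phiC -bez rmorphD !rmorphM phix phiy !mulr0 addr0.
Qed.

End GenericLines.

(** Where E i0 vanishes on the line, so does one of its prime factors; this factor
    does not divide some E i, and shares no zero with it on a generic line. *)
Lemma common_zeros_codim2 (K : fieldType) n (I : Type) (E : I -> {mpoly K[n]}) i0 b :
  E i0 != 0 -> (forall p, prime_elt p -> exists i, ~ divides p (E i)) ->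
  exists2 r : {mpoly K[n]}, r != 0 & forall a, r.@[a] != 0 ->
    forall t, exists i, (E i).@[fun k => a k + t * b k] != 0.
Proof.
move=> Ei0 cop; suff [r r0 rP] : exists2 r : {mpoly K[n]}, r != 0 &
    forall a, r.@[a] != 0 -> forall t, (E i0).@[fun k => a k + t * b k] = 0 ->
      exists i, (E i).@[fun k => a k + t * b k] != 0.
  exists r => // a ra t; have [z|nz] := eqVneq (E i0).@[fun k => a k + t * b k] 0.
    exact: rP ra t z.
  by exists i0.
elim: (ufd_mpoly Ei0) => [u /unitrP [u' [u'u _]]|p e pp _ [r r0 rP]].
  exists 1 => [|a _ t uz]; first exact: oner_neq0.
  move/(congr1 (meval (fun k => a k + t * b k))): u'u.
  by rewrite mevalM uz mulr0 meval1 => /esym/eqP; rewrite oner_eq0.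
have [i npi] := cop p pp; have [s s0 sP] := prime_coprime_line b pp npi.
exists (s * r) => [|a]; first exact: mulf_neq0.
rewrite mevalM mulf_eq0 negb_or => /andP[sa ra] t; rewrite mevalM => /eqP.
rewrite mulf_eq0 => /orP[/eqP pz|/eqP]; last exact: rP.
by exists i; apply: contraNneq sa => hz; rewrite (sP a t).
Qed.

(** * Generic points *)

Section GenericPoints.
Variable K : numFieldType.

(** All that is needed of a polynomial function; this form is stable under affine
    maps and spares coordinates on V * V. *)
Definition pol_on_lines (W : lmodType K) (phi : W -> K) : Prop :=
  forall x y, exists P : {poly K}, forall t, phi (x + t *: y) = P.[t].

(** On the line through x and y both functions are nonzero polynomials. *)
Lemma common_nonzero (W : lmodType K) (phi psi : W -> K) x y :
  pol_on_lines phi -> pol_on_lines psi -> phi x != 0 -> psi y != 0 ->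
  exists2 z, phi z != 0 & psi z != 0.
Proof.
move=> phiP psiP; have [P PE] := phiP x (y - x); have [Q QE] := psiP x (y - x).
move=> phix psiy; have P0 : P != 0.
  by apply: contraNneq phix => P0; rewrite -[x]addr0 -(scale0r (y - x)) PE P0 horner0.
have Q0 : Q != 0.
  apply: contraNneq psiy => Q0.
  by rewrite -[y](subrKC x) -[y - x]scale1r QE Q0 horner0.
have /poly_nonroot [t] := mulf_neq0 P0 Q0.
rewrite hornerM mulf_eq0 negb_or => /andP[Pt Qt].
by exists (x + t *: (y - x)); rewrite ?PE ?QE.
Qed.

Lemma pol_on_linesM (W : lmodType K) (phi psi : W -> K) :
  pol_on_lines phi -> pol_on_lines psi -> pol_on_lines (fun x => phi x * psi x).
Proof.
move=> phiP psiP x y; have [P PE] := phiP x y; have [Q QE] := psiP x y.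
by exists (P * Q) => t; rewrite PE QE hornerM.
Qed.

Lemma pol_on_linesB (W : lmodType K) (phi psi : W -> K) :
  pol_on_lines phi -> pol_on_lines psi -> pol_on_lines (fun x => phi x - psi x).
Proof.
move=> phiP psiP x y; have [P PE] := phiP x y; have [Q QE] := psiP x y.
by exists (P - Q) => t; rewrite PE QE hornerD hornerN.
Qed.

Lemma pol_on_lines_affine (W W' : lmodType K) (phi : W -> K) (h : W' -> W) :
  (forall x y, exists y', forall t, h (x + t *: y) = h x + t *: y') ->
  pol_on_lines phi -> pol_on_lines (fun x => phi (h x)).
Proof.
move=> hP phiP x y; have [y' hE] := hP x y; have [P PE] := phiP (h x) y'.
by exists P => t; rewrite hE PE.
Qed.

Variable V : vectType K.

Lemma vcoordD (x y : V) t i : vcoord (x + t *: y) i = vcoord x i + t * vcoord y i.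
Proof. by rewrite /vcoord linearD linearZ. Qed.

Lemma veval_line (p : vpoly V) x y t :
  veval p (x + t *: y) = (on_line (vcoord x) (vcoord y) p).[t].
Proof.
by rewrite on_lineE; apply: meval_eq => i; rewrite vcoordD.
Qed.

Lemma pol_on_lines_veval (p : vpoly V) : pol_on_lines (veval p).
Proof.
by move=> x y; exists (on_line (vcoord x) (vcoord y) p) => t; apply: veval_line.
Qed.

Lemma vcoord_surj (c : 'I_(\dim {:V}) -> K) : exists x : V, vcoord x =1 c.
Proof.
exists (\sum_i c i *: (vbasis {:V})`_i) => i; rewrite /vcoord.
by rewrite coord_sum_free //; apply: basis_free (vbasisP _).
Qed.

Lemma veval_nonroot (p : vpoly V) : p != 0 -> exists x, veval p x != 0.
Proof.
case/mpoly_nonroot => c pc; have [x xc] := vcoord_surj c.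
by exists x; rewrite /veval (meval_eq _ xc).
Qed.

Lemma veval_inj (p p' : vpoly V) : (forall x, veval p x = veval p' x) -> p = p'.
Proof.
move=> eqp; apply/eqP; rewrite -subr_eq0; apply: contrapT => /negP /veval_nonroot [x].
by rewrite /veval mevalB -!/(veval _ x) eqp subrr eqxx.
Qed.

Lemma generically_pol (P : V -> Prop) : generically P ->
  exists phi : V -> K, [/\ pol_on_lines phi, exists x, phi x != 0
                         & forall x, phi x != 0 -> P x].
Proof.
case=> O [[I OI] [x0 Ox0] OP]; have [p Ip px0] := (OI x0).1 Ox0.
exists (veval p); split; first exact: pol_on_lines_veval.
  by exists x0.
by move=> x px; apply: OP; apply/OI; exists p.
Qed.

End GenericPoints.

(** * Differentials along a line, in a frame of the kernel of the pencil *)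

Lemma kernel_frame_size (K : fieldType) m (ker : 'rV[{poly K}]_m -> Prop) vs q :
  size vs = q -> kernel_frame ker vs ->
  exists (S T : 'M[K]_(m, q)) (Phi : 'M[{poly K}]_(q, m)),
    (forall j k, (size (Phi j k) <= nth 0%N vs j)%N) /\
    forall phi : 'rV_m, ker phi ->
      phi = (phi *m map_mx polyC S) *m Phi /\
      forall j, (phi *m map_mx polyC T) 0 j
                  = (phi *m map_mx polyC S) 0 j * 'X^((nth 0%N vs j).-1).
Proof. by move=> <-. Qed.

Lemma det_neq0_perm (R : idomainType) q (A : 'M[R]_q) :
  \det A != 0 -> exists s : 'S_q, forall i, A i (s i) != 0.
Proof.
move=> detA; apply: contrapT => nex; case/negP: detA; apply/eqP.
apply: big1 => s _; have [i Ai] : exists i, A i (s i) = 0.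
  apply: contrapT => nz; apply: nex; exists s => i.
  by apply/eqP => Ai; apply: nz; exists i.
by rewrite (bigD1 i) //= Ai mul0r mulr0.
Qed.

Lemma msize_mderiv_tdeg (K : numFieldType) n (p : {mpoly K[n]}) k :
  (msize p^`M(k) <= tdeg p)%N.
Proof.
have [->|dp0] := eqVneq p^`M(k) 0; first by rewrite msize0.
by rewrite /tdeg -ltnS prednK ?msize_mderiv_lt // (leq_ltn_trans _ (msize_mderiv_lt dp0)).
Qed.

Section LineFrame.
Variables (K : numClosedFieldType) (n q : nat) (f : q.-tuple {mpoly K[n]}).
Variables (a b : 'I_n -> K) (w : 'I_q -> nat).
Variables (S T : 'M[K]_(n, q)) (Phi : 'M[{poly K}]_(q, n)).
Variable ker : 'rV[{poly K}]_n -> Prop.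

Definition grad_line (h : {mpoly K[n]}) : 'rV[{poly K}]_n :=
  map_mx (on_line a b) (grad h).

Hypothesis w_gt0 : forall j, (0 < w j)%N.
Hypothesis size_Phi : forall j k, (size (Phi j k) <= w j)%N.
Hypothesis frame : forall phi : 'rV[{poly K}]_n, ker phi ->
  phi = (phi *m map_mx polyC S) *m Phi /\
  forall j, (phi *m map_mx polyC T) 0 j
              = (phi *m map_mx polyC S) 0 j * 'X^((w j).-1).
Hypothesis ker_f : forall i, ker (grad_line (tnth f i)).

Local Notation M := (map_mx (on_line a b) (jacobian f)).
Local Notation G := (M *m map_mx polyC S).
Local Notation d i := (tdeg (tnth f i)).

Lemma row_jacobian_line i : row i M = grad_line (tnth f i).
Proof. by apply/rowP => k; rewrite !mxE. Qed.

Lemma jacobian_frame : M = G *m Phi.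
Proof.
apply/row_matrixP => i; rewrite !row_mul row_jacobian_line.
exact: (frame (ker_f i)).1.
Qed.

Lemma jacobian_lead i j : (M *m map_mx polyC T) i j = G i j * 'X^((w j).-1).
Proof.
have := (frame (ker_f i)).2 j; rewrite -row_jacobian_line -!row_mul.
by rewrite ![row i _ 0 j]mxE.
Qed.

Lemma on_line_jminor N : on_line a b (jminor f N) = \det (M *m map_mx polyC N).
Proof.
rewrite /jminor -det_map_mx map_mxM -map_mx_comp; congr (\det (_ *m _)).
by apply/matrixP => k j; rewrite !mxE /= on_lineC.
Qed.

Lemma on_line_jminor_frame N :
  on_line a b (jminor f N) = \det G * \det (Phi *m map_mx polyC N).
Proof. by rewrite on_line_jminor {1}jacobian_frame -mulmxA det_mulmx. Qed.

(** T selects the entries of top degree of Phi. *)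
Lemma on_line_jminor_lead :
  on_line a b (jminor f T) = \det G * 'X^(\sum_j (w j).-1).
Proof.
rewrite on_line_jminor.
have -> : M *m map_mx polyC T = G *m diag_mx (\row_j 'X^((w j).-1)).
  by apply/matrixP => i j; rewrite jacobian_lead mul_mx_diag !mxE.
rewrite det_mulmx det_diag expr_sum; congr (_ * _).
by apply: eq_bigr => j _; rewrite mxE.
Qed.

Lemma size_jacobian_line i (N : 'M[K]_(n, q)) j : (size ((M *m map_mx polyC N) i j) <= d i)%N.
Proof.
rewrite mxE; apply: leq_trans (size_sum _ _ _) _; apply/bigmax_leqP => k _.
rewrite !mxE mulrC mul_polyC; apply: leq_trans (size_scale_leq _ _) _.
exact: leq_trans (size_on_line _ _ _) (msize_mderiv_tdeg _ _).
Qed.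

(** A nonzero term of det G matches each f_i with a row of Phi whose degree does
    not exceed that of the differential. *)
Lemma frame_degrees : \det G != 0 -> exists s : 'S_q, forall i, (w (s i) <= d i)%N.
Proof.
case/det_neq0_perm => s Gs; exists s => i.
have := size_jacobian_line i T (s i); rewrite jacobian_lead.
rewrite size_Mmonic ?monicXn // size_polyXn.
have := Gs i; rewrite -size_poly_gt0.
by move: (size _) (tdeg _) (w (s i)) (w_gt0 (s i)) => x y z; lia.
Qed.

Hypothesis d_gt0 : forall i, (0 < d i)%N.

Lemma sum_pred (e : 'I_q -> nat) : (forall i, (0 < e i)%N) ->
  (\sum_i e i = \sum_i (e i).-1 + q)%N.
Proof.
move=> e0; rewrite -[X in (_ + X)%N](card_ord q) -sum1_card -big_split.
by apply: eq_bigr => i _ /=; rewrite addn1 prednK.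
Qed.

(** The minor attached to T has degree at most sum (d_i - 1), and is det G times
    X^(sum (w_j - 1)). *)
Lemma size_det_frame : \det G != 0 ->
  (size (\det G) + \sum_j w j <= (\sum_i d i).+1)%N.
Proof.
move=> G0; have sM i j : (size ((M *m map_mx polyC T) i j) <= (d i).-1.+1)%N.
  by rewrite prednK // size_jacobian_line.
have := (coef_top_det sM).1; rewrite -on_line_jminor on_line_jminor_lead.
rewrite size_Mmonic ?monicXn // size_polyXn (sum_pred w_gt0) (sum_pred d_gt0).
by move: (size _) (\sum_j _)%N (\sum_i _)%N => x y z; lia.
Qed.

Lemma det_frame_const : \det G != 0 -> (\sum_i d i = \sum_j w j)%N ->
  exists2 c, c != 0 & \det G = c%:P.
Proof.
move=> G0 eqS; have := size_det_frame G0; rewrite eqS -addn1 addnC leq_add2l => sz1.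
exists (\det G)`_0; last exact: size1_polyC.
by apply: contraNneq G0 => c0; rewrite (size1_polyC sz1) c0.
Qed.

(** For homogeneous f_i and a generic direction b, the minors have the maximal
    degree in t; the excess over the degrees of the rows of Phi is deg det G. *)
Lemma det_frame_root N :
  (forall i, tnth f i \is (d i).-homog) -> (jminor f N).@[b] != 0 ->
  (\sum_j w j < \sum_i d i)%N ->
  exists t, forall N', (on_line a b (jminor f N')).[t] = 0.
Proof.
move=> homf Nb ltS.
have sM i j : (size ((M *m map_mx polyC N) i j) <= (d i).-1.+1)%N.
  by rewrite prednK // size_jacobian_line.
have szN : (\sum_i (d i).-1 < size (on_line a b (jminor f N)))%N.
  rewrite ltnNge; apply/negP => /leq_sizeP /(_ _ (leqnn _)).
  rewrite on_line_jminor (coef_top_det sM).2 => det0; case/negP: Nb; apply/eqP.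
  rewrite -[RHS]det0 /jminor -det_map_mx; congr (\det _); apply/matrixP => i j.
  rewrite !mxE coef_sum rmorph_sum; apply: eq_bigr => k _ /=.
  rewrite !mxE mevalM mevalC coefMC; congr (_ * _).
  by rewrite on_line_homog // mderiv_homog.
have szPhi : (size (\det (Phi *m map_mx polyC N)) <= (\sum_j (w j).-1).+1)%N.
  apply: (coef_top_det _).1 => i j; rewrite prednK // mxE.
  apply: leq_trans (size_sum _ _ _) _; apply/bigmax_leqP => k _.
  by rewrite mxE mulrC mul_polyC; apply: leq_trans (size_scale_leq _ _) (size_Phi _ _).
have szG : size (\det G) != 1.
  apply/eqP => szG; move: szN; rewrite on_line_jminor_frame.
  have := size_polyMleq (\det G) (\det (Phi *m map_mx polyC N)).
  move: ltS szPhi; rewrite szG (sum_pred w_gt0) (sum_pred d_gt0).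
  by move: (size _) (size _) (\sum_j _)%N (\sum_i _)%N => x y z t; lia.
have [t tG] := closed_rootP (\det G) szG.
exists t => N'; rewrite on_line_jminor_frame hornerM.
by move/eqP: tG => ->; rewrite mul0r.
Qed.

(** Any kernel vector is a combination of the rows of M with denominator det G,
    so Cramer's formulas on the columns combined by N hold for it. *)
Lemma frame_cramer (phi : 'rV_n) (N : 'M[K]_(n, q)) : ker phi -> \det G != 0 ->
  \det (M *m map_mx polyC N) *: phi
    = phi *m map_mx polyC N *m \adj (M *m map_mx polyC N) *m M.
Proof.
move=> kphi G0; pose y := phi *m map_mx polyC S; pose z := y *m \adj G.
have phiE : \det G *: phi = z *m M.
  have adjK (A : 'M_q) (B : 'M_(q, n)) : \det A *: (y *m B) = y *m \adj A *m (A *m B).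
    by rewrite mulmxA -(mulmxA y) mul_adj_mx mul_mx_scalar scalemxAl.
  by rewrite {1}(frame kphi).1 -/y adjK -jacobian_frame.
apply/rowP => k; apply: (mulfI G0).
have zE : \det G *: (\det (M *m map_mx polyC N) *: phi)
   = \det G *: (phi *m map_mx polyC N *m \adj (M *m map_mx polyC N) *m M).
  rewrite scalerA mulrC -scalerA phiE !scalemxAl phiE.
  by rewrite -[z *m M *m _]mulmxA -(mulmxA z (M *m _)) mul_mx_adj mul_mx_scalar
    /z /y !scalemxAl.
by move/rowP/(_ k): zE; rewrite !mxE.
Qed.

End LineFrame.

(** The indices i <= k are matched with k + 1 of the w_j, all of them at most d_k,
    so the k-th term of the sorted w_j is at most d_k. *)
Lemma sorted_matching q (d : 'I_q -> nat) (w : seq nat) (v : q.-tuple nat) (s : 'S_q) :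
  (forall i j : 'I_q, (i <= j)%N -> (d i <= d j)%N) ->
  (forall i, (nth 0%N w (s i) <= d i)%N) ->
  v = sort leq w :> seq nat -> forall i, (tnth v i <= d i)%N.
Proof.
move=> dmono wd vw i; rewrite leqNgt; apply/negP => lt_dv.
have szw : size w = q by rewrite -(size_sort leq) -vw size_tuple.
pose P x := (x < tnth v i)%N.
have le_count : (count P v <= i)%N.
  rewrite -{1}(cat_take_drop i v) count_cat.
  have -> : count P (drop i v) = 0.
    apply/eqP; rewrite -leqn0 leqNgt -has_count; apply/hasPn => x.
    case/(nthP 0%N) => k; rewrite size_drop nth_drop => ltk <-.
    rewrite /P -leqNgt (tnth_nth 0%N).
    have sv : sorted leq v by rewrite vw; apply: sort_sorted; exact: leq_total.
    apply: (sorted_leq_nth leq_trans leqnn 0%N sv); rewrite ?inE ?leq_addr //.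
      by rewrite size_tuple.
    by move: ltk; rewrite size_tuple; lia.
  rewrite addn0; apply: leq_trans (count_size _ _) _.
  by rewrite size_take; case: ltnP.
have : (i < count P w)%N.
  have -> : count P w = #|[set j : 'I_q | P (nth 0%N w j)]|.
    rewrite -{1}(mkseq_nth 0%N w) /mkseq szw -val_enum_ord -map_comp count_map.
    by rewrite cardE size_filter -enumT; apply: eq_count => j; rewrite /= inE.
  have card_le : (i < #|[set k : 'I_q | (k <= i)%N]|)%N.
    rewrite -[X in (X <= _)%N](card_ord i.+1).
    pose h (k : 'I_i.+1) : 'I_q := widen_ord (ltn_ord i) k.
    rewrite -(card_codom (f := h)); last by move=> k k' /(congr1 val) /= /val_inj.
    apply/subset_leq_card/subsetP => _ /codomP [k ->]; rewrite inE /= -ltnS.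
    exact: ltn_ord.
  apply: leq_trans card_le _; rewrite -(card_imset _ (@perm_inj _ s)).
  apply/subset_leq_card/subsetP => j /imsetP [k]; rewrite inE => ki ->.
  by rewrite inE /P; apply: leq_ltn_trans (wd k) (leq_ltn_trans (dmono _ _ ki) lt_dv).
have/seq.permP <- : perm_eq v w by rewrite vw perm_sort.
by rewrite ltnNge le_count.
Qed.

(** * Linear vector fields and the divisor of the minors *)

Section DerivationDet.
Variables (R : comNzRingType) (D : R -> R).
Hypotheses (DD : {morph D : x y / x + y}) (DM : forall x y, D (x * y) = D x * y + x * D y).

Let D0 : D 0 = 0.
Proof. by apply: (addrI (D 0)); rewrite -DD !addr0. Qed.

Let DN x : D (- x) = - D x.
Proof. by apply: (addrI (D x)); rewrite -DD !subrr. Qed.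

Let D1 : D 1 = 0.
Proof. by apply: (addrI (D 1)); have := DM 1 1; rewrite !mul1r mulr1 addr0 => <-. Qed.

Let D_sum (I : Type) (r : seq I) (P : pred I) (F : I -> R) :
  D (\sum_(i <- r | P i) F i) = \sum_(i <- r | P i) D (F i).
Proof. exact: (big_morph D DD D0). Qed.

Lemma derivation_prod (I : finType) (F : I -> R) :
  D (\prod_i F i) = \sum_c \prod_i (if i == c then D (F i) else F i).
Proof.
elim: (index_enum I) (index_enum_uniq I) => [_|i r IH /= /andP[ir ur]].
  by rewrite !big_nil.
rewrite !big_cons DM IH // eqxx; congr (_ * _ + _).
  rewrite big_seq [RHS]big_seq; apply: eq_bigr => k kr.
  by case: eqP kr ir => // -> ->.
rewrite mulr_sumr big_seq [RHS]big_seq; apply: eq_bigr => c cr.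
rewrite big_cons; case: eqP cr ir => [-> -> //|_ _ _].
by [].
Qed.

Lemma derivation_det q (B : 'M[R]_q) :
  D (\det B) = \sum_c \det (\matrix_(i, j) if j == c then D (B i j) else B i j).
Proof.
rewrite -det_tr D_sum; under [RHS]eq_bigr do rewrite -det_tr.
rewrite exchange_big; apply: eq_bigr => s _ /=.
have Dsign (e : bool) x : D ((-1) ^+ e * x) = (-1) ^+ e * D x.
  by case: e; rewrite ?mulN1r ?mul1r.
rewrite Dsign derivation_prod mulr_sumr; apply: eq_bigr => c _; congr (_ * _).
by apply: eq_bigr => i _; rewrite !mxE.
Qed.

End DerivationDet.

Section LinearField.
Variables (K : numFieldType) (n : nat) (A : 'M[K]_n).
Implicit Types h : {mpoly K[n]}.

Definition linear_field h : {mpoly K[n]} :=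
  \sum_k h^`M(k) * \sum_j A k j *: 'X_j.

Lemma linear_fieldD : {morph linear_field : x y / x + y}.
Proof.
move=> x y; rewrite /linear_field -big_split; apply: eq_bigr => k _ /=.
by rewrite mderivD mulrDl.
Qed.

Lemma linear_fieldM x y :
  linear_field (x * y) = linear_field x * y + x * linear_field y.
Proof.
rewrite /linear_field mulr_suml mulr_sumr -big_split; apply: eq_bigr => k _ /=.
by rewrite mderivM; ring.
Qed.

Lemma linear_field_exp x m :
  linear_field (x ^+ m.+1) = m.+1%:R * x ^+ m * linear_field x.
Proof.
elim: m => [|m IH]; first by rewrite expr0 !mulr1 mul1r.
rewrite exprS linear_fieldM {}IH exprS -[m.+2]addn1 natrD; ring.
Qed.

Lemma linear_field_comp q (P : {mpoly K[q]}) (f : q.-tuple {mpoly K[n]}) :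
  (forall j, linear_field (tnth f j) = 0) -> linear_field (P \mPo f) = 0.
Proof.
move=> f0; rewrite /linear_field; under eq_bigr do rewrite mderiv_comp mulr_suml.
rewrite exchange_big big1 // => j _ /=.
under eq_bigr do rewrite -mulrA; rewrite -mulr_sumr -/(linear_field _) f0 mulr0 //.
Qed.

Lemma msize_linear_field h : (msize (linear_field h) <= msize h)%N.
Proof.
apply: leq_trans (msize_sum _ _ _) _; apply/bigmax_leqP => k _.
have [->|dh0] := eqVneq h^`M(k) 0; first by rewrite mul0r msize0.
set l := \sum_j _; have szl : (msize l <= 2)%N.
  apply: leq_trans (msize_sum _ _ _) _; apply/bigmax_leqP => j _.
  by apply: leq_trans (msizeZ_le _ _) _; rewrite msizeX mdeg1.
have [->|l0] := eqVneq l 0; first by rewrite mulr0 msize0.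
rewrite msizeM //; have := msize_mderiv_lt dh0.
by move: (msize _) (msize l) (msize h) szl => x y z; lia.
Qed.

(** Differentiating the invariance of the f_i. *)
Lemma linear_field_jacobian q (f : q.-tuple {mpoly K[n]}) i j :
  linear_field (tnth f i) = 0 ->
  linear_field (jacobian f i j) = - (jacobian f *m map_mx (@mpolyC n K) A) i j.
Proof.
move/(congr1 (mderiv j)); rewrite mderiv0 raddf_sum /= => eq0.
apply/eqP; rewrite -addr_eq0 -[X in _ == X]eq0 [(_ *m _) _ _]mxE /linear_field -big_split.
apply/eqP; apply: eq_bigr => k _ /=; rewrite mderivM !mxE mderiv_comm.
congr (_ + _ * _); rewrite raddf_sum (bigD1 j) //= big1 ?addr0 => [|l lj].
  by rewrite mderivZ mderiv_var eqxx -mul_mpolyC mulr1.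
by rewrite mderivZ mderiv_var (negPf lj) scaler0.
Qed.

(** The field acts on the columns, hence maps the linear span of the minors into
    itself. *)
Lemma linear_field_jminor q (f : q.-tuple {mpoly K[n]}) N :
  (forall i, linear_field (tnth f i) = 0) ->
  linear_field (jminor f N) =
    \sum_c jminor f (\matrix_(k, j) if j == c then - (A *m N) k j else N k j).
Proof.
move=> f0; rewrite /jminor (derivation_det linear_fieldD linear_fieldM).
apply: eq_bigr => c _; congr (\det _); apply/matrixP => i j; rewrite mxE.
case: ifP => jc; last first.
  by rewrite !mxE; apply: eq_bigr => k _; rewrite !mxE jc.
have field_sum (F : 'I_n -> {mpoly K[n]}) :
    linear_field (\sum_k F k) = \sum_k linear_field (F k).
  apply: (big_morph _ linear_fieldD).
  by rewrite /linear_field big1 // => k _; rewrite mderiv0 mul0r.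
have fieldC c' : linear_field c'%:MP = 0.
  by rewrite /linear_field big1 // => k _; rewrite mderivC mul0r.
rewrite mxE field_sum.
transitivity (- (jacobian f *m map_mx (@mpolyC n K) A *m map_mx (@mpolyC n K) N) i j).
  rewrite mxE -sumrN; apply: eq_bigr => k _.
  rewrite linear_fieldM linear_field_jacobian // [X in linear_field X]mxE fieldC.
  by rewrite mulr0 addr0 mulNr.
rewrite -mulmxA -map_mxM [X in - X]mxE [RHS]mxE -sumrN; apply: eq_bigr => k _.
by rewrite !mxE jc mpolyCN mulrN.
Qed.

(** Let p^m be the highest power of p dividing all minors and p^m w a minor that
    p^(m+1) does not divide. The image of this minor is a sum of minors, so p^m
    divides m p^(m-1) (field p) w + p^m (field w), and p divides (field p) w. *)
Lemma prime_divides_field q (f : q.-tuple {mpoly K[n]}) p :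
  (forall i, linear_field (tnth f i) = 0) ->
  (exists N, jminor f N != 0) -> prime_elt p ->
  (forall N, divides p (jminor f N)) -> divides p (linear_field p).
Proof.
move=> f0 [N0 N00] pp pN; have [p0 p1 pM] := pp.
have szp : (1 < msize p)%N.
  rewrite ltnNge; apply/negP => /msize1_polyC pC; apply: p1.
  have c0 : p@_0%MM != 0 by apply: contraNneq p0 => c0; rewrite pC c0.
  by exists ((p@_0%MM)^-1)%:MP; rewrite {2}pC -rmorphM mulVf.
have bounded m : divides (p ^+ m) (jminor f N0) -> (m <= msize (jminor f N0))%N.
  case=> s def_N; have s0 : s != 0 by apply: contraNneq N00 => s0; rewrite def_N s0 mul0r.
  have szX k : (k < msize (p ^+ k))%N.
    elim: k => [|k IH]; first by rewrite expr0 msize1.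
    rewrite exprS msizeM ?expf_neq0 //.
    by move: (msize p) (msize _) szp IH => x y; lia.
  rewrite def_N msizeM ?expf_neq0 //; have := szX m.
  by move: s0; rewrite -msize_poly_eq0; move: (msize s) (msize _) => x y; lia.
have [m pm maxm] : exists2 m, forall N, divides (p ^+ m.+1) (jminor f N) &
    exists N, ~ divides (p ^+ m.+2) (jminor f N).
  pose P m := `[< forall N, divides (p ^+ m.+1) (jminor f N) >].
  have exP : exists m, P m by exists 0%N; apply/asboolP => N; rewrite expr1.
  have ubP m : P m -> (m <= msize (jminor f N0))%N.
    by move/asboolP/(_ N0)/bounded/ltnW.
  case: (ex_maxnP exP ubP) => m /asboolP Pm maxm; exists m => //.
  apply: contrapT => nex; have : P m.+1.
    by apply/asboolP => N; apply: contrapT => nN; apply: nex; exists N.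
  by move/maxm; rewrite ltnn.
have [N nN] := maxm; have [w def_N] := pm N.
have nw : ~ divides p w.
  by case=> c def_w; apply: nN; exists c; rewrite def_N def_w -mulrA -exprS.
have : divides (p ^+ m.+1) (linear_field (jminor f N)).
  by rewrite linear_field_jminor //; apply: divides_sum => c _; apply: pm.
rewrite def_N linear_fieldM linear_field_exp => -[c eqc].
have : divides p (w * (m.+1%:R * linear_field p)).
  have {}eqc : w * (m.+1%:R * p ^+ m * linear_field p) = (c - linear_field w) * p ^+ m.+1.
    by rewrite mulrBl -eqc addrAC subrr add0r.
  exists (c - linear_field w); apply: (mulfI (expf_neq0 m p0)).
  transitivity ((c - linear_field w) * p ^+ m.+1); last by rewrite exprS; ring.
  by rewrite -eqc; ring.
case/pM => // -[c' eqc'].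
exists ((m.+1%:R^-1)%:MP * c'); rewrite -mulrA -eqc' mulrA.
rewrite -(mpolyC_nat n K) -mpolyCM mulVf ?mpolyC1 ?mul1r //.
by rewrite Num.Theory.pnatr_eq0.
Qed.

End LinearField.

(** * Invariants of a representation *)

Section Representation.
Variables (K : numClosedFieldType) (g V : vectType K) (rho : 'Hom(g, 'End(V))).
Local Notation n := (\dim {:V}).
Implicit Types (h p : vpoly V) (a b x : V) (xi : g).

Definition act_mx xi : 'M[K]_n :=
  \matrix_(k, j) vcoord (rho xi (vbasis {:V})`_j) k.

Lemma vcoord_act xi x k : vcoord (rho xi x) k = \sum_j act_mx xi k j * vcoord x j.
Proof.
rewrite {1}(vcoordP x) linear_sum /vcoord linear_sum; apply: eq_bigr => j _ /=.
by rewrite !linearZ /= mxE mulrC.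
Qed.

Lemma veval_linear_field xi h x :
  veval (linear_field (act_mx xi) h) x = vdiff h x (rho xi x).
Proof.
rewrite /veval raddf_sum; apply: eq_bigr => k _ /=.
rewrite mevalM vcoord_act; congr (_ * _); rewrite raddf_sum; apply: eq_bigr => j _ /=.
by rewrite mevalZ mevalXU.
Qed.

Lemma invariantP h :
  is_invariant rho h <-> forall xi, linear_field (act_mx xi) h = 0.
Proof.
split=> [inv xi|inv x xi]; last by rewrite -veval_linear_field inv /veval meval0.
by apply: veval_inj => x; rewrite veval_linear_field inv /veval meval0.
Qed.

Lemma invariant_comp q (f : q.-tuple (vpoly V)) (P : {mpoly K[q]}) :
  (forall i, is_invariant rho (tnth f i)) -> is_invariant rho (P \mPo f).
Proof.
move=> inv; apply/invariantP => xi; apply: linear_field_comp => j.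
exact: (invariantP _).1.
Qed.

(** Expand dh(a + t b)(rho(xi)(a + t b)) = 0 in powers of t. *)
Lemma invariant_kills a b h : is_invariant rho h ->
  kills_pencil (orbit_map rho a) (orbit_map rho b)
    (grad_line (vcoord a) (vcoord b) h).
Proof.
move=> inv xi; apply/eqP; apply: contrapT => /negP/poly_nonroot [t].
case/negP; rewrite -(inv (a + t *: b) xi) horner_sum /vdiff; apply/eqP.
apply: eq_bigr => k _; rewrite !mxE hornerM on_lineE; congr (_ * _).
  by apply: meval_eq => i; rewrite vcoordD.
by rewrite !hornerE !orbit_mapE linearD linearZ vcoordD.
Qed.

(** The quotient of the two is a constant because the field does not raise
    degrees, and it is linear in xi since one point suffices to compute it. *)
Lemma field_semi_invariant p : p != 0 ->
  (forall xi, divides p (linear_field (act_mx xi) p)) -> is_semi_invariant rho p.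
Proof.
move=> p0 pdiv; have [x0 px0] := veval_nonroot p0.
have lin : linear (fun xi => vdiff p x0 (rho xi x0) / veval p x0 : K^o).
  move=> c xi xi'; have rhoE : rho (c *: xi + xi') x0 = rho xi' x0 + c *: rho xi x0.
    by rewrite linearP add_lfunE scale_lfunE addrC.
  rewrite scalerAl -mulrDl rhoE; congr (_ / _).
  rewrite scaler_sumr -big_split; apply: eq_bigr => k _ /=.
  by rewrite vcoordD mulrDr addrC mulrCA.
pose chi := linfun (HB.pack (fun xi => vdiff p x0 (rho xi x0) / veval p x0 : K^o)
                     (GRing.isLinear.Build K g K^o _ _ lin) : {linear g -> K^o}).
exists chi => x xi.
have [s def_s] := pdiv xi.
have [c sC] : exists c, s = c%:MP.
  have [->|s0] := eqVneq s 0; first by exists 0; rewrite mpolyC0.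
  exists (s@_0%MM); apply: msize1_polyC.
  have := msize_linear_field (act_mx xi) p; rewrite def_s msizeM //.
  move: p0; rewrite -msize_poly_eq0; move: (msize s) (msize p) => y z; lia.
have fieldE y : vdiff p y (rho xi y) = c * veval p y.
  by rewrite -veval_linear_field def_s sC /veval mevalM mevalC.
by rewrite /chi lfunE /= !fieldE mulfK.
Qed.

End Representation.

Section VerticalIndices.
Variables (K : numClosedFieldType) (g V : vectType K) (rho : 'Hom(g, 'End(V))).
Local Notation n := (\dim {:V}).
(* a pair is generic when gen does not vanish; ws lists the vertical indices *)
Variables (q : nat) (f : q.-tuple (vpoly V)) (ws : seq nat) (gen : V * V -> K).
Local Notation d i := (tdeg (tnth f i)).
Local Notation w := (nth 0%N ws).

Hypothesis inv_f : forall i, is_invariant rho (tnth f i).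
Hypothesis ind_f : alg_independent f.
Hypothesis size_ws : size ws = q.
Hypothesis ws_gt0 : forall j : 'I_q, (0 < w j)%N.
Hypothesis gen_pol : pol_on_lines gen.
Hypothesis gen_nz : exists ab, gen ab != 0.
Hypothesis gen_frame : forall ab, gen ab != 0 ->
  kernel_frame (kills_pencil (orbit_map rho ab.1) (orbit_map rho ab.2)) ws.

Lemma pol_fst (phi : V -> K) : pol_on_lines phi ->
  pol_on_lines (fun ab : V * V => phi ab.1).
Proof.
by apply: pol_on_lines_affine => x y; exists y.1 => t.
Qed.

Lemma pol_snd (phi : V -> K) : pol_on_lines phi ->
  pol_on_lines (fun ab : V * V => phi ab.2).
Proof.
by apply: pol_on_lines_affine => x y; exists y.2 => t.
Qed.

Lemma pol_add (phi : V -> K) : pol_on_lines phi ->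
  pol_on_lines (fun ab : V * V => phi (ab.1 + ab.2)).
Proof.
apply: pol_on_lines_affine => x y; exists (y.1 + y.2) => t /=.
by rewrite scalerDr addrACA.
Qed.

(** The Jacobian criterion for P = 0. *)
Lemma nonzero_minor : exists N, jminor f N != 0.
Proof.
have [||||N nN] := @jacobian_criterion K n q f 0.
- move=> r s [c]; rewrite comp_mpoly0 mulr0 => /eqP.
  by rewrite mulf_eq0 => /orP[]/eqP ->; [left|right]; apply: divides0.
- by case=> c; rewrite comp_mpoly0 mulr0 => /eqP; rewrite oner_eq0.
- by [].
- move=> Q [c]; rewrite comp_mpoly0 mulr0 => /ind_f ->; exact: divides0.
exists N; apply: contra_notN nN => /eqP ->; exact: divides0.
Qed.

Local Notation line a b := (on_line (vcoord a) (vcoord b)).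

Lemma frameP a b : gen (a, b) != 0 ->
  exists (S T : 'M[K]_(n, q)) (Phi : 'M[{poly K}]_(q, n)),
    (forall j k, (size (Phi j k) <= w j)%N) /\
    forall phi : 'rV_n, kills_pencil (orbit_map rho a) (orbit_map rho b) phi ->
      phi = (phi *m map_mx polyC S) *m Phi /\
      forall j, (phi *m map_mx polyC T) 0 j
                  = (phi *m map_mx polyC S) 0 j * 'X^((w j).-1).
Proof. by move/gen_frame; apply: kernel_frame_size. Qed.

Let kills_f a b i : kills_pencil (orbit_map rho a) (orbit_map rho b)
  (grad_line (vcoord a) (vcoord b) (tnth f i)).
Proof. exact: invariant_kills. Qed.

Lemma det_frame_neq0 a b S T Phi N t :
  (forall phi : 'rV_n, kills_pencil (orbit_map rho a) (orbit_map rho b) phi ->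
      phi = (phi *m map_mx polyC S) *m Phi /\
      forall j : 'I_q, (phi *m map_mx polyC T) 0 j
                  = (phi *m map_mx polyC S) 0 j * 'X^((w j).-1)) ->
  veval (jminor f N) (a + t *: b) != 0 ->
  \det (map_mx (line a b) (jacobian f) *m map_mx polyC S) != 0.
Proof.
move=> frame; apply: contraNneq => G0.
by rewrite veval_line (on_line_jminor_frame frame (kills_f a b)) G0 mul0r horner0.
Qed.

Lemma vertical_index_le : exists s : 'S_q, forall i, (w (s i) <= d i)%N.
Proof.
have [N /veval_nonroot [a0 Na0]] := nonzero_minor; have [ab0 gab0] := gen_nz.
have [[a b] gab /= Na] := common_nonzero (y := (a0, a0)) gen_pol
  (pol_fst (pol_on_lines_veval (jminor f N))) gab0 Na0.
have [S [T [Phi [szPhi frame]]]] := frameP gab.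
apply: (frame_degrees ws_gt0 frame (kills_f a b)).
by apply: (det_frame_neq0 (t := 0) frame (N := N)); rewrite scale0r addr0.
Qed.

Lemma degree_gt0 i : (0 < d i)%N.
Proof. by have [s ws_le] := vertical_index_le; apply: leq_trans (ws_le i). Qed.

Lemma prime_nonconst (p : {mpoly K[n]}) : prime_elt p -> exists b : V, veval p b != veval p (0 : V).
Proof.
case=> p0 p1 _; apply: contrapT => const; apply: p1.
have pC : p = (veval p (0 : V))%:MP.
  apply: veval_inj => x; rewrite [RHS]/veval mevalC; apply: contrapT => /eqP px.
  by apply: const; exists x.
have c0 : veval p (0 : V) != 0 by apply: contraNneq p0 => c0; rewrite pC c0.
by exists ((veval p (0 : V))^-1)%:MP; rewrite {2}pC -rmorphM mulVf.
Qed.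

Section EqualDegrees.
Hypothesis eq_sum : (\sum_i d i = \sum_(j < q) w j)%N.

(** A prime divisor of all minors vanishes somewhere on a generic line, while the
    minor reading off the coefficients in the frame is constant there. *)
Lemma minors_coprime (p : {mpoly K[n]}) : prime_elt p -> exists N, ~ divides p (jminor f N).
Proof.
move=> pp; apply: contrapT => nex.
have pN N : divides p (jminor f N) by apply: contrapT => np; apply: nex; exists N.
have [N /veval_nonroot [a0 Na0]] := nonzero_minor; have [ab0 gab0] := gen_nz.
have [b1 pb1] := prime_nonconst pp.
have [ab1 gab1 /= Nab1] := common_nonzero (y := (a0, a0)) gen_pol
  (pol_fst (pol_on_lines_veval (jminor f N))) gab0 Na0.
have gN : gen ab1 * veval (jminor f N) ab1.1 != 0 by rewrite mulf_neq0.
have pdiff : veval p ((0 : V, b1).1 + (0 : V, b1).2) - veval p (0 : V, b1).1 != 0.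
  by rewrite /= add0r subr_eq0.
have [[a b]] := common_nonzero (y := (0 : V, b1))
  (pol_on_linesM gen_pol (pol_fst (pol_on_lines_veval (jminor f N))))
  (pol_on_linesB (pol_add (pol_on_lines_veval p)) (pol_fst (pol_on_lines_veval p)))
  gN pdiff.
rewrite mulf_eq0 negb_or subr_eq0 /= => /andP[gab Na] pab.
have [S [T [Phi [szPhi frame]]]] := frameP gab.
have G0 : \det (map_mx (line a b) (jacobian f) *m map_mx polyC S) != 0.
  by apply: (det_frame_neq0 (t := 0) frame (N := N)); rewrite scale0r addr0.
have [c c0 Gc] := det_frame_const ws_gt0 frame (kills_f a b) degree_gt0 G0 eq_sum.
have [t /eqP pt] : exists t, root (line a b p) t.
  apply: closed_rootP; apply/eqP => szp; case/negP: pab.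
  have pc := size1_polyC (eq_leq szp).
  have : veval p (a + 1 *: b) = veval p (a + 0 *: b) by rewrite !veval_line pc !hornerC.
  by rewrite scale1r scale0r addr0 => ->.
have := divides_rmorph (line a b) (pN S).
rewrite /= on_line_jminor Gc => -[s /(congr1 (fun P : {poly K} => P.[t]))].
by rewrite hornerC hornerM pt mulr0; apply/eqP.
Qed.

(** On a generic line the minor attached to T is a nonzero constant times
    X^(sum (w_j - 1)). *)
Lemma top_degree_minor : exists T, (\sum_i (d i).-1 < msize (jminor f T))%N.
Proof.
have [N /veval_nonroot [a0 Na0]] := nonzero_minor; have [ab0 gab0] := gen_nz.
have [[a b] gab /= Na] := common_nonzero (y := (a0, a0)) gen_pol
  (pol_fst (pol_on_lines_veval (jminor f N))) gab0 Na0.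
have [S [T [Phi [szPhi frame]]]] := frameP gab.
have G0 : \det (map_mx (line a b) (jacobian f) *m map_mx polyC S) != 0.
  by apply: (det_frame_neq0 (t := 0) frame (N := N)); rewrite scale0r addr0.
exists T; apply: leq_trans (size_on_line (vcoord a) (vcoord b) _).
rewrite (on_line_jminor_lead frame (kills_f a b)) size_Mmonic ?monicXn // size_polyXn.
have := eq_sum; rewrite (sum_pred ws_gt0) (sum_pred degree_gt0) => /addIn ->.
by rewrite addnS -[X in (X < _)%N]add0n ltn_add2r size_poly_gt0.
Qed.

End EqualDegrees.

(** On a generic line the differential of an invariant lies in the kernel of the
    pencil, where Cramer's formulas hold; so they hold identically. *)
Lemma invariant_dependent h : is_invariant rho h ->
  exists (r : {mpoly K[n]}) (c : 'rV_q), r != 0 /\ r *: grad h = c *m jacobian f.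
Proof.
move=> inv_h; have [N N0] := nonzero_minor.
set JN := jacobian f *m map_mx (@mpolyC n K) N.
exists (jminor f N), (grad h *m map_mx (@mpolyC n K) N *m \adj JN); split=> //.
apply/eqP; rewrite -subr_eq0; apply: contrapT => /negP/rV0Pn [k Ek].
have /veval_nonroot [a1 Ea1] := Ek; have /veval_nonroot [a0 Na0] := N0.
have [ab0 gab0] := gen_nz.
have [ab1 gab1 /= Nab1] := common_nonzero (y := (a0, a0)) gen_pol
  (pol_fst (pol_on_lines_veval (jminor f N))) gab0 Na0.
have gN : gen ab1 * veval (jminor f N) ab1.1 != 0 by rewrite mulf_neq0.
have [[a b]] := common_nonzero (y := (a1, a1))
  (pol_on_linesM gen_pol (pol_fst (pol_on_lines_veval (jminor f N))))
  (pol_fst (pol_on_lines_veval _)) gN Ea1.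
rewrite mulf_eq0 negb_or /= => /andP[gab Na] Ea.
have [S [T [Phi [szPhi frame]]]] := frameP gab.
have G0 : \det (map_mx (line a b) (jacobian f) *m map_mx polyC S) != 0.
  by apply: (det_frame_neq0 (t := 0) frame (N := N)); rewrite scale0r addr0.
have := frame_cramer frame (kills_f a b) N (invariant_kills a b inv_h) G0.
have mapC : map_mx polyC N = map_mx (line a b) (map_mx (@mpolyC n K) N).
  by apply/matrixP => i j; rewrite !mxE /= on_lineC.
rewrite -on_line_jminor mapC -!map_mxM -map_mx_adj -!map_mxM -map_mxZ.
move/rowP/(_ k); rewrite [LHS]mxE [RHS]mxE => eqk; case/negP: Ea; apply/eqP.
rewrite -[a](addr0 a) -(scale0r b) veval_line.
rewrite [X in line a b X]mxE [(- _ : 'rV_n) 0 k]mxE rmorphB /= eqk subrr horner0 //.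
Qed.

(** On a generic line all minors vanish at a root of det G; without a common
    factor they would have no common zero there. *)
Lemma common_divisor N :
  (forall i, tnth f i \is (d i).-homog) -> jminor f N != 0 ->
  (\sum_(j < q) w j < \sum_i d i)%N ->
  exists2 p, prime_elt p & forall N', divides p (jminor f N').
Proof.
move=> homf N0 lt_sum; apply: contrapT => nex.
have cop p : prime_elt p -> exists N', ~ divides p (jminor f N').
  move=> pp; apply: contrapT => nN; apply: nex; exists p => // N'.
  by apply: contrapT => np; apply: nN; exists N'.
have /veval_nonroot [b0 Nb0] := N0; have [ab0 gab0] := gen_nz.
have [[a1 b] gab1 /= Nb] := common_nonzero (y := (b0, b0)) gen_pol
  (pol_snd (pol_on_lines_veval (jminor f N))) gab0 Nb0.
have [r /veval_nonroot [a0 ra0] rP] := common_zeros_codim2 (vcoord b) N0 cop.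
have gen_pol1 : pol_on_lines (fun a => gen (a, b)).
  move=> x y; have [P PE] := gen_pol (x, b) (y, 0); exists P => t.
  by rewrite -PE; congr gen; congr pair; rewrite /= scaler0 addr0.
have [a gab ra] := common_nonzero gen_pol1 (pol_on_lines_veval r) gab1 ra0.
have [S [T [Phi [szPhi frame]]]] := frameP gab.
have [t tN] := det_frame_root ws_gt0 szPhi frame (kills_f a b) degree_gt0 homf Nb lt_sum.
have [N' /eqP] := rP _ ra t; apply.
by rewrite -on_lineE tN.
Qed.

End VerticalIndices.

(** * Degrees of invariants and vertical indices *)

Lemma vertical_heights_gt0 ts j : (j < size (vertical_heights ts))%N ->
  (0 < nth 0%N (vertical_heights ts) j)%N.
Proof.
move=> ltj; suff /allP/(_ _ (mem_nth 0%N ltj)) : all (leq 1) (vertical_heights ts) by [].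
by elim: ts {ltj} => //= -[k l|k|k|k] ts IH.
Qed.

(** The quotient of two invariants, if polynomial, is an invariant, hence a
    polynomial in f. *)
Lemma relations_modulo_invariant (K : numClosedFieldType) (g V : vectType K)
    (rho : 'Hom(g, 'End(V))) q (f : q.-tuple (vpoly V)) (P : {mpoly K[q]}) :
  freely_generates (is_invariant rho) f -> P \mPo f != 0 ->
  forall Q, divides (P \mPo f) (Q \mPo f) -> divides P Q.
Proof.
move=> [indf genf] Pf0 Q [c QE].
have inv (S : {mpoly K[q]}) : is_invariant rho (S \mPo f) by apply/genf; exists S.
have /genf [C cE] : is_invariant rho c.
  apply/invariantP => xi; apply: (mulIf Pf0).
  have /invariantP/(_ xi) := inv Q; rewrite QE linear_fieldM.
  by have /invariantP -> := inv P; rewrite mulr0 addr0 mul0r.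
exists C; apply/eqP; rewrite -subr_eq0; apply/eqP/indf.
by rewrite rmorphB rmorphM /= QE cE subrr.
Qed.

Theorem vertical_indices_and_degrees (K : numClosedFieldType) (g V : vectType K)
    (rho : 'Hom(g, 'End(V))) (q : nat) (f : q.-tuple (vpoly V)) (v : q.-tuple nat) :
  (forall i : 'I_q, is_invariant rho (tnth f i)) ->
  alg_independent f ->
  (forall i j : 'I_q, (i <= j)%N -> (tdeg (tnth f i) <= tdeg (tnth f j))%N) ->
  vertical_indices rho v ->
  [/\ (forall i : 'I_q, tdeg (tnth f i) = tnth v i) <->
        (\sum_(i < q) tdeg (tnth f i) = \sum_(i < q) tnth v i)%N,
      (forall i : 'I_q, tdeg (tnth f i) = tnth v i) ->
        freely_generates (is_invariant rho) f
    & (forall i : 'I_q, exists d : nat, tnth f i \is d.-homog) ->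
      freely_generates (is_invariant rho) f ->
      no_proper_semi_invariants rho ->
      forall i : 'I_q, tdeg (tnth f i) = tnth v i].
Proof.
move=> inv_f ind_f deg_sorted [ts [gen_ts v_sort]].
set ws := vertical_heights ts in v_sort.
have size_ws : size ws = q by rewrite -(size_sort leq) -v_sort size_tuple.
have ws_gt0 (j : 'I_q) : (0 < nth 0%N ws j)%N.
  by apply: vertical_heights_gt0; rewrite -/ws size_ws.
have [gen [gen_pol gen_nz genP]] := generically_pol gen_ts.
have gen_frame ab : gen ab != 0 ->
    kernel_frame (kills_pencil (orbit_map rho ab.1) (orbit_map rho ab.2)) ws.
  by move/genP => [bs /jk_form_kernel frame ts_bs]; rewrite /ws -ts_bs.
have [s ws_le] := vertical_index_le inv_f ind_f size_ws ws_gt0 gen_pol gen_nz gen_frame.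
have d_gt0 := degree_gt0 inv_f ind_f size_ws ws_gt0 gen_pol gen_nz gen_frame.
have v_le := sorted_matching deg_sorted ws_le v_sort.
have sum_v : (\sum_(i < q) tnth v i = \sum_(j < q) nth 0%N ws j)%N.
  rewrite -(big_tuple _ _ v predT id) v_sort (perm_big ws) ?perm_sort //=.
  by rewrite (big_nth 0%N) size_ws big_mkord.
have eq_sumP : (forall i : 'I_q, tdeg (tnth f i) = tnth v i) <->
    (\sum_(i < q) tdeg (tnth f i) = \sum_(i < q) tnth v i)%N.
  split=> [eqd|eqS i]; first by apply: eq_bigr => i _; apply: eqd.
  have := leqif_sum (fun (i : 'I_q) (_ : true) =>
    (v_le i, erefl (tnth v i == tdeg (tnth f i))) : leqif _ _ _).
  by case=> _; rewrite eqS eqxx => /esym/forallP/(_ i)/eqP.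
split=> // [/eq_sumP|homf [_ gen_f] no_semi].
  rewrite sum_v => eq_sum; split=> // h; split=> [inv_h|[P ->]]; last first.
    exact: invariant_comp.
  have [T degT] := top_degree_minor inv_f ind_f size_ws ws_gt0 gen_pol gen_nz gen_frame eq_sum.
  apply: (generated_by_tuple ind_f _ degT).
    by move=> p; apply: (minors_coprime inv_f ind_f size_ws ws_gt0 gen_pol gen_nz gen_frame eq_sum).
  exact: (invariant_dependent inv_f ind_f size_ws gen_pol gen_nz gen_frame).
apply/eq_sumP; apply: contrapT => /eqP neq_sum.
have lt_sum : (\sum_(j < q) nth 0%N ws j < \sum_i tdeg (tnth f i))%N.
  by rewrite -sum_v ltn_neqAle eq_sym neq_sum leq_sum.
have [N N0] := nonzero_minor ind_f.
have {}homf i : tnth f i \is (tdeg (tnth f i)).-homog.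
  by have [e /dhomog_msize] := homf i.
have [p pp pN] := common_divisor inv_f ind_f size_ws ws_gt0 gen_pol gen_nz gen_frame
  homf N0 lt_sum.
have [p0 p1 pM] := pp.
have /no_semi /gen_f [P pE] : is_semi_invariant rho p.
  apply: field_semi_invariant => // xi; apply: (prime_divides_field (f := f)) => //.
    by move=> i; apply: (invariantP _ _).1.
  by exists N.
have [||||N' []] := @jacobian_criterion K _ q f P; rewrite -?pE //.
- by move=> p_eq0; rewrite p_eq0 eqxx in p0.
- by move=> Q; rewrite pE; apply: relations_modulo_invariant => //; rewrite -pE.
Qed.

Theorem theorem5p11 (R : realType) (g V : vectType R[i])
    (br : g -> g -> g) (rho : 'Hom(g, 'End(V)))
    (q : nat) (f : q.-tuple (vpoly V)) (v : q.-tuple nat)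
    (hbr : is_lie_bracket br)
    (hrho : is_lie_rep br rho)
    (hq : is_codim_reg rho q)
    (hinv : forall i : 'I_q, is_invariant rho (tnth f i))
    (hind : alg_independent f)
    (hsort : forall i j : 'I_q, (i <= j)%N ->
       (tdeg (tnth f i) <= tdeg (tnth f j))%N)
    (hv : vertical_indices rho v) :
  [/\ (forall i : 'I_q, tdeg (tnth f i) = tnth v i) <->
        (\sum_(i < q) tdeg (tnth f i) = \sum_(i < q) tnth v i)%N,
      (forall i : 'I_q, tdeg (tnth f i) = tnth v i) ->
        freely_generates (is_invariant rho) f
    & (forall i : 'I_q, exists d : nat, tnth f i \is d.-homog) ->
      freely_generates (is_invariant rho) f ->
      no_proper_semi_invariants rho ->
      forall i : 'I_q, tdeg (tnth f i) = tnth v i].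
Proof. exact: (vertical_indices_and_degrees hinv hind hsort hv). Qed.
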